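(* Let $n \ge 2$. If $x, y \in X$ lie in the same orbit under $\Phi^t$, then $$d_n(\Psi_x, \Psi_y) \le \min\{ |t| : t \in \mathbb R,\ x = \Phi^t(y)\}.$$
   Context: Setting. $X$ is a $C^\infty$ manifold and $\Phi^t \colon X \to X$, $t \in \mathbb R$, is a flow generated by a $C^\infty$ vector field $\vec V$, with derivation $Vf = \vec V \cdot \nabla f$ on $C^\infty(X)$. $\mathcal H \subset C^\infty(X)$ is a complex reproducing kernel Hilbert space (RKHS) with strictly positive-definite kernel $k$ and kernel sections $k_x = k(x,\cdot)$, so $f(x) = \langle k_x, f\rangle_{\mathcal H}$ (inner products conjugate-linear in the first argument). As an unbounded operator on $\mathcal H$, $V$ has domain $\{f \in \mathcal H : Vf \in \mathcal H\}$; $V^*$ is its adjoint. Standing assumption 1. (a) $V \colon \mathcal H \to C(X)$ is continuous for the compact-open topology on $C(X)$. (b) $\mathcal H_\infty \subseteq \mathrm{dom}(V) \cap \mathrm{dom}(V^* )$ is a dense subspace of $\mathcal H$ invariant under $V$ and $V^*$. (c) With $V_1 = V$, $V_2 = V^*$, for every $f \in \mathcal H_\infty$ the series $\sum_{n=0}^\infty \frac{z^n}{n!} \sum_{\epsilon \colon [n] \to [2]} \lVert V_{\epsilon(1)} \cdots V_{\epsilon(n)} f \rVert_{\mathcal H}$ has a strictly positive radius of convergence, where $[n]=\{1,\dots,n\}$. Standing assumption 2. $\mathcal H$ is a reproducing kernel Hilbert algebra: $k_x \mapsto k_x \otimes k_x$ extends to a bounded linear map $\mathcal H \to \mathcal H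 \otimes \mathcal H$. $\mathcal S \subset \mathcal H_\infty$ is a finite-dimensional subspace such that the subalgebra generated by $\mathcal S$ is dense in $\mathcal H$. Standing assumption 3. $\lVert k_x\rVert_{\mathcal H} = 1$ for all $x \in X$. First amplification. On $\mathcal H_\infty$, $A = (V-V^* )/2$, $S = (V+V^* )/2$. $\mathfrak H = \ell^2(\mathbb N) \otimes \mathcal H$, $\mathfrak H_0 = C_c(\mathbb N) \otimes_{\mathrm{alg}} \mathcal H_\infty$, $e_i$ is the canonical basis of $\ell^2(\mathbb N)$, $e_{i,j}$ the matrix units ($e_{i,j}e_j = e_i$), and $L = \sum_{i\ge 1} (e_{i,i+1} \otimes S + e_{i,i} \otimes A - e_{i+1,i} \otimes S)$ on $\mathfrak H_0$. $E_n f = \sum_{i=1}^n F_i\, e_i \otimes f$ with $F_i$ the Fibonacci numbers ($F_1=F_2=1$), $E_n\colon \mathcal H \to \mathfrak H$. Fock space. $\mathfrak H^{\vee n}$ is the closed subspace of symmetric tensors in $\mathfrak H^{\otimes n}$ ($\mathfrak H^{\vee 0} = \mathbb C$); $u_1 \vee \cdots \vee u_n = \frac1{n!}\sum_{\sigma \in S_n} u_{\sigma(1)} \otimes \cdots \otimes u_{\sigma(n)}$. $\mathfrak F$ is the Hilbert space completion of $\bigoplus_{n\ge0} (\mathfrak H^{\vee n}, w(n)^2 \langle\cdot,\cdot\rangle_{\mathfrak H^{\vee n}})$, with weights $w(n) = e^{\tau n^p}$, $\tau>0$, $p \in (0,1)$; $\vee$ extends to a bounded bilinear commutative unital multiplication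 on $\mathfrak F$. $\mathcal D$ is the operator on $\mathfrak F$ with domain the linear span of $1 \in \mathbb C$ and all $v_1 \vee\cdots\vee v_n$, $v_i \in \mathfrak H_0$, given by $\mathcal D 1 = 0$ and $\mathcal D(v_1 \vee \cdots \vee v_n) = \sum_i v_1 \vee \cdots \vee Lv_i \vee \cdots \vee v_n$ (it is essentially skew-adjoint). Operators, states, metric. For $u \in \mathfrak H$, $a_u^* \in B(\mathfrak F)$ is $a_u^*\eta = u \vee \eta$ and $a_u$ is its adjoint. $\mathcal A_n \subset B(\mathfrak F)$ is the $*$-algebra generated by $\mathrm{Id}_{\mathfrak F}$ and $\{a_{E_nf} : f \in \mathcal S\}$; $\mathcal A \supset \mathcal A_n$ is the $C^*$-algebra generated by $\mathrm{Id}_{\mathfrak F}$ and $\{a_u : u \in \mathfrak H_0\}$. For $a \in \mathcal A_n$, $[\mathcal D,a] = \mathcal D a - a \mathcal D$ extends to a bounded operator on $\mathfrak F$, with norm $\lVert[\mathcal D,a]\rVert$. For $x \in X$, $m \in \mathbb N$, $\mathcal K_x^{(m)} = \sum_{n=m}^\infty w(n)^{-2} (e_1 \otimes k_x)^{\vee n}$, $\varphi_x^m(a) = \langle \mathcal K_x^{(m)}, a \mathcal K_x^{(m)}\rangle_{\mathfrak F}/\lVert \mathcal K_x^{(m)}\rVert_{\mathfrak F}^2$, and $\Psi_x(a) = \lim_{m\to\infty} \varphi_x^m(a)$ for $a \in \mathcal A$; this limit exists and defines a state of $\mathcal A$. The extended pseudometric $d_n$ is $$d_n(\varphi,\psi)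 = \sup\{ |\varphi(a) - \psi(a)| : a \in \mathcal A_n,\ \lVert [\mathcal D, a]\rVert \le 1\} \in [0,\infty].$$ *)

(* Defs.v *)
From HB Require Import structures.
From mathcomp Require Import all_boot all_order all_algebra perm.
From mathcomp Require Import all_classical all_reals all_analysis.
From mathcomp Require Import complex.

Set Implicit Arguments.
Unset Strict Implicit.
Unset Printing Implicit Defensive.

Import Order.TTheory GRing.Theory Num.Theory.
Import numFieldNormedType.Exports.

Local Open Scope classical_set_scope.
Local Open Scope ring_scope.
Local Open Scope complex_scope.

(* R[i] with its structure packed, so that it inherits the norm topology that
   the library puts on every numClosedFieldType. Its norm takes values in the
   nonnegative elements of R[i] itself; complex.Re brings it back to R. *)
Definition cplx (R : realType) : numClosedFieldType := R[i].

Fixpoint C_k (R : realType) (E F : normedModType R) (k : nat) (U : set E)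
    (f : E -> F) : Prop :=
  if k is k'.+1 then
    (forall p, U p -> differentiable f p) /\
    (forall v, C_k k' U (fun p => 'D_v f p))
  else forall p, U p -> {for p, continuous f}.

(* Meant for an open set U. *)
Definition smooth_on (R : realType) (E F : normedModType R) (U : set E)
    (f : E -> F) : Prop := forall k, C_k k U f.

Record chart (R : realType) (d : nat) (X : topologicalType) := Chart {
  chart_dom : set X ;
  chart_map : X -> 'rV[R]_d ;
  chart_inv : 'rV[R]_d -> X ;
  chart_domO : open chart_dom ;
  chart_imgO : open (chart_map @` chart_dom) ;
  chart_mapK : forall x, chart_dom x -> chart_inv (chart_map x) = x ;
  chart_map_cont : {within chart_dom, continuous chart_map} ;
  chart_inv_cont : {within chart_map @` chart_dom, continuous chart_inv} }.

(* The atlas comes with the choice mf_at of one of its charts around every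
   point. *)
Record manifold (R : realType) (d : nat) (X : topologicalType) := Manifold {
  mf_index : Type ;
  mf_chart : mf_index -> chart R d X ;
  mf_at : X -> mf_index ;
  mf_hausdorff : hausdorff_space X ;
  mf_countable : @second_countable X ;
  mf_at_dom : forall x, chart_dom (mf_chart (mf_at x)) x ;
  mf_transition : forall i j,
    smooth_on
      (chart_map (mf_chart i) @`
         (chart_dom (mf_chart i) `&` chart_dom (mf_chart j)))
      (chart_map (mf_chart j) \o chart_inv (mf_chart i)) }.

Arguments mf_chart {R d X} m i.

Definition smooth_fun (R : realType) (d : nat) (X : topologicalType)
    (M : manifold R d X) (f : X -> cplx R) : Prop :=
  forall i, let c := mf_chart M i in
    smooth_on (chart_map c @` chart_dom c)
              (fun p => complex.Re (f (chart_inv c p)) : R) /\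
    smooth_on (chart_map c @` chart_dom c)
              (fun p => complex.Im (f (chart_inv c p)) : R).

(* vf_comp i x is the vector of components, in the i-th chart, of the tangent
   vector at x; it is meaningful for x in the domain of that chart. *)
Record vector_field (R : realType) (d : nat) (X : topologicalType)
    (M : manifold R d X) := VectorField {
  vf_comp : mf_index M -> X -> 'rV[R]_d ;
  vf_smooth : forall i, let c := mf_chart M i in
    smooth_on (chart_map c @` chart_dom c) (vf_comp i \o chart_inv c) ;
  vf_change : forall i j x,
    chart_dom (mf_chart M i) x -> chart_dom (mf_chart M j) x ->
    vf_comp j x =
      'D_(vf_comp i x) (chart_map (mf_chart M j) \o chart_inv (mf_chart M i))
                       (chart_map (mf_chart M i) x) }.

Arguments vf_comp {R d X M} v i x.

(* V . grad f, computed in the chosen chart around x; for smooth f the value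
   does not depend on this chart. *)
Definition vf_der (R : realType) (d : nat) (X : topologicalType)
    (M : manifold R d X) (V : vector_field M) (f : X -> cplx R) (x : X) :
    cplx R :=
  let i := mf_at M x in
  let c := mf_chart M i in
  ('D_(vf_comp V i x) (fun p => complex.Re (f (chart_inv c p)) : R)
     (chart_map c x))
  +i*
  ('D_(vf_comp V i x) (fun p => complex.Im (f (chart_inv c p)) : R)
     (chart_map c x)).

Record is_flow (R : realType) (d : nat) (X : topologicalType)
    (M : manifold R d X) (V : vector_field M) (Phi : R -> X -> X) : Prop := {
  flow0 : forall x, Phi 0 x = x ;
  flowD : forall s t x, Phi (s + t) x = Phi s (Phi t x) ;
  flow_cont : forall x, continuous (fun t : R => Phi t x) ;
  flow_generator : forall x t i, chart_dom (mf_chart M i) (Phi t x) ->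
    is_derive t (1 : R) (fun s : R => chart_map (mf_chart M i) (Phi s x))
              (vf_comp V i (Phi t x)) }.

HB.mixin Record isHilbert (R : realType) H
    & CompleteNormedModule (cplx R) H := {
  dot : H -> H -> cplx R ;
  dot_linr : forall (f : H) (a : cplx R) (g h : H),
    dot f (a *: g + h) = a * dot f g + dot f h ;
  dotC : forall f g : H, dot g f = (dot f g)^* ;
  dot_norm : forall f : H, dot f f = `|f| ^+ 2 }.

#[short(type="hilbertType")]
HB.structure Definition Hilbert (R : realType) :=
  { H of isHilbert R H & CompleteNormedModule (cplx R) H }.

Arguments dot {R s}.

Inductive span (R : realType) (E : hilbertType R) (A : set E) : set E :=
| span0 : span A 0
| spanD (a : cplx R) u v : A u -> span A v -> span A (a *: u + v).

Definition subspace (R : realType) (E : hilbertType R) (A : set E) : Prop :=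
  A 0 /\ forall (a : cplx R) u v, A u -> A v -> A (a *: u + v).

(* Unbounded operators are represented by their graphs: G u v means that u is
   in the domain and is mapped to v. *)
Definition op_dom (R : realType) (E : hilbertType R) (G : E -> E -> Prop) :
  set E := [set u | exists v, G u v].

(* The value of the operator at u; 0 outside of the domain. *)
Definition op_app (R : realType) (E : hilbertType R) (G : E -> E -> Prop)
  (u : E) : E := xget 0 [set v | G u v].

Definition op_adj (R : realType) (E : hilbertType R) (G : E -> E -> Prop)
  (f g : E) : Prop := forall h Gh, G h Gh -> dot f Gh = dot g h.

(* The linear operator determined by its values on a spanning set. *)
Inductive lin_ext (R : realType) (E : hilbertType R) (G : E -> E -> Prop) :
    E -> E -> Prop :=
| lin_ext0 : lin_ext G 0 0
| lin_extD (a : cplx R) u v u' v' :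
    G u v -> lin_ext G u' v' -> lin_ext G (a *: u + u') (a *: v + v').

(* ell^2(N), presented by its canonical basis; ell2_e i is the basis vector
   usually written e_(i+1). *)
Record ell2 (R : realType) := Ell2 {
  ell2_space :> hilbertType R ;
  ell2_e : nat -> ell2_space ;
  ell2_dot : forall i j, dot (ell2_e i) (ell2_e j) = (i == j)%:R ;
  ell2_dense : dense (span (range ell2_e)) }.

Arguments ell2_e {R} e i.

(* A Hilbert space tensor product, i.e. a completion of the algebraic tensor
   product; it is unique up to a unitary isomorphism. *)
Record tensor_product (R : realType) (H1 H2 : hilbertType R) := TensorProduct {
  tp_space :> hilbertType R ;
  tp : H1 -> H2 -> tp_space ;
  tp_linl : forall (a : cplx R) u u' v,
    tp (a *: u + u') v = a *: tp u v + tp u' v ;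
  tp_linr : forall (a : cplx R) u v v',
    tp u (a *: v + v') = a *: tp u v + tp u v' ;
  tp_dot : forall u u' v v', dot (tp u v) (tp u' v') = dot u u' * dot v v' ;
  tp_dense : dense (span [set t | exists u v, t = tp u v]) }.

Arguments tp {R H1 H2} t u v : rename.

(* The n-fold Hilbert space tensor power, with the map sending v to
   v_1 (x) ... (x) v_n. *)
Record tensor_power (R : realType) (H : hilbertType R) (n : nat) :=
TensorPower {
  tpow_space :> hilbertType R ;
  tens : ('I_n -> H) -> tpow_space ;
  tens_lin : forall (i : 'I_n) (a : cplx R) (u u' : H) (v : 'I_n -> H),
    tens (fun j => if j == i then a *: u + u' else v j) =
    a *: tens (fun j => if j == i then u else v j)
      + tens (fun j => if j == i then u' else v j) ;
  tens_dot : forall u v, dot (tens u) (tens v) = \prod_i dot (u i) (v i) ;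
  tens_dense : dense (span (range tens)) }.

Arguments tens {R H n} t v : rename.

(* Invariance under all the unitaries U_s permuting the factors, expressed by
   <U_s^* (v_1 (x) ... (x) v_n), t> = <v_1 (x) ... (x) v_n, t>. *)
Definition symmetric_tensor (R : realType) (H : hilbertType R) (n : nat)
    (T : tensor_power H n) (t : T) : Prop :=
  forall (s : 'S_n) (v : 'I_n -> H),
    dot (tens T (fun i => v (s i))) t = dot (tens T v) t.

(* v_1 \/ ... \/ v_n for a sequence v of length n. *)
Definition vee (R : realType) (H : hilbertType R)
    (T : forall n, tensor_power H n) (v : seq H) : T (size v) :=
  ((size v)`!%:R : cplx R)^-1 *:
    \sum_(s : 'S_(size v)) tens (T (size v)) (fun i => v`_(s i)).

(* A completion of the direct sum of the spaces of symmetric tensors, the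
   n-th summand carrying the inner product scaled by w(n)^2. *)
Record fock (R : realType) (H : hilbertType R)
    (T : forall n, tensor_power H n) (w : nat -> R) := Fock {
  fock_space :> hilbertType R ;
  fock_in : forall n, T n -> fock_space ;
  fock_in_lin : forall n (a : cplx R) (s t : T n),
    symmetric_tensor s -> symmetric_tensor t ->
    fock_in (a *: s + t) = a *: fock_in s + fock_in t ;
  fock_in_dot : forall n (s t : T n),
    symmetric_tensor s -> symmetric_tensor t ->
    dot (fock_in s) (fock_in t) = (w n ^+ 2)%:C * dot s t ;
  fock_in_orth : forall m n (s : T m) (t : T n),
    symmetric_tensor s -> symmetric_tensor t -> m != n ->
    dot (fock_in s) (fock_in t) = 0 ;
  fock_dense : dense (span [set eta | exists n, exists2 t : T n,
    symmetric_tensor t & eta = fock_in t]) }.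

Arguments fock_in {R H T w} F n t : rename.

Definition fvee (R : realType) (H : hilbertType R)
    (T : forall n, tensor_power H n) (w : nat -> R) (F : fock T w)
    (v : seq H) : F := fock_in F (size v) (vee T v).

(* The function on X given by f; k x is the kernel section at x. *)
Definition rk_eval (R : realType) (X : topologicalType) (H : hilbertType R)
  (k : X -> H) (f : H) : X -> cplx R := fun x => dot (k x) f.

Record is_rkhs (R : realType) (d : nat) (X : topologicalType)
    (M : manifold R d X) (H : hilbertType R) (k : X -> H) : Prop := {
  rkhs_inj : injective (rk_eval k) ;
  rkhs_smooth : forall f, smooth_fun M (rk_eval k f) ;
  rkhs_strict : forall n (z : 'I_n -> X) (c : 'I_n -> cplx R),
    injective z -> (exists i, c i != 0) ->
    0 < \sum_i \sum_j (c i)^* * c j * rk_eval k (k (z i)) (z j) }.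

(* V as an operator on H, with domain {f in H : V f in H}. *)
Definition Vgraph (R : realType) (d : nat) (X : topologicalType)
    (M : manifold R d X) (V : vector_field M) (H : hilbertType R) (k : X -> H)
    (f g : H) : Prop := rk_eval k g = vf_der V (rk_eval k f).

Definition Vop (R : realType) (d : nat) (X : topologicalType)
    (M : manifold R d X) (V : vector_field M) (H : hilbertType R)
    (k : X -> H) : H -> H := op_app (Vgraph V k).

Definition Vadj (R : realType) (d : nat) (X : topologicalType)
    (M : manifold R d X) (V : vector_field M) (H : hilbertType R)
    (k : X -> H) : H -> H := op_app (op_adj (Vgraph V k)).

(* V_eps(1) ... V_eps(n) f *)
Definition Vword (R : realType) (d : nat) (X : topologicalType)
    (M : manifold R d X) (V : vector_field M) (H : hilbertType R) (k : X -> H)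
    (n : nat) (eps : {ffun 'I_n -> bool}) (f : H) : H :=
  foldr (fun i g => (if eps i then Vadj V k else Vop V k) g) f (enum 'I_n).

Record assumption1 (R : realType) (d : nat) (X : topologicalType)
    (M : manifold R d X) (V : vector_field M) (H : hilbertType R) (k : X -> H)
    (Hinf : set H) : Prop := {
  a1_cont : continuous
    (fun f : H => vf_der V (rk_eval k f) : {compact-open, X -> cplx R}) ;
  a1_dom : Hinf `<=` op_dom (Vgraph V k) `&` op_dom (op_adj (Vgraph V k)) ;
  a1_subspace : subspace Hinf ;
  a1_dense : dense Hinf ;
  a1_inv : forall f, Hinf f -> Hinf (Vop V k f) /\ Hinf (Vadj V k f) ;
  a1_analytic : forall f, Hinf f -> exists2 r : R, 0 < r &
    cvgn (series (fun n => r ^+ n / n`!%:R *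
      \sum_(eps : {ffun 'I_n -> bool}) complex.Re `|Vword V k eps f|)) }.

(* The subalgebra of H, for the pointwise multiplication of functions,
   generated by S. *)
Inductive subalgebra (R : realType) (X : topologicalType) (H : hilbertType R)
    (k : X -> H) (S : set H) : set H :=
| subalg_gen f : S f -> subalgebra k S f
| subalg_lin (a : cplx R) f g : subalgebra k S f -> subalgebra k S g ->
    subalgebra k S (a *: f + g)
| subalg_mul f g h : subalgebra k S f -> subalgebra k S g ->
    (forall x, rk_eval k h x = rk_eval k f x * rk_eval k g x) ->
    subalgebra k S h.

Record assumption2 (R : realType) (X : topologicalType) (H : hilbertType R)
    (k : X -> H) (HH : tensor_product H H) (Hinf S : set H) : Prop := {
  a2_comul : exists2 D : {linear H -> HH}, continuous D &
    forall x, D (k x) = tp HH (k x) (k x) ;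
  a2_sub : S `<=` Hinf ;
  a2_findim : exists s : seq H, S = span [set` s] ;
  a2_dense : dense (subalgebra k S) }.

Definition Aop (R : realType) (d : nat) (X : topologicalType)
    (M : manifold R d X) (V : vector_field M) (H : hilbertType R) (k : X -> H)
    (f : H) : H := (2%:R : cplx R)^-1 *: (Vop V k f - Vadj V k f).

Definition Sop (R : realType) (d : nat) (X : topologicalType)
    (M : manifold R d X) (V : vector_field M) (H : hilbertType R) (k : X -> H)
    (f : H) : H := (2%:R : cplx R)^-1 *: (Vop V k f + Vadj V k f).

Definition h0 (R : realType) (H : hilbertType R) (l2 : ell2 R)
    (hh : tensor_product l2 H) (Hinf : set H) : set hh :=
  span [set u | exists i f, Hinf f /\ u = tp hh (ell2_e l2 i) f].

(* The value L (e_i (x) f); the term e_(i-1) (x) S f, coming from the matrix unit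
   e_(i-1,i), is absent for the first basis vector. *)
Definition Lsimple (R : realType) (d : nat) (X : topologicalType)
    (M : manifold R d X) (V : vector_field M) (H : hilbertType R) (k : X -> H)
    (l2 : ell2 R) (hh : tensor_product l2 H) (i : nat) (f : H) : hh :=
  (if i is i'.+1 then tp hh (ell2_e l2 i') (Sop V k f) else 0)
  + tp hh (ell2_e l2 i) (Aop V k f)
  - tp hh (ell2_e l2 i.+1) (Sop V k f).

Arguments h0 {R H l2} hh Hinf _.

Definition Lop (R : realType) (d : nat) (X : topologicalType)
    (M : manifold R d X) (V : vector_field M) (H : hilbertType R) (k : X -> H)
    (Hinf : set H) (l2 : ell2 R) (hh : tensor_product l2 H) : hh -> hh :=
  op_app (lin_ext (fun u v => exists i f,
    [/\ Hinf f, u = tp hh (ell2_e l2 i) f & v = Lsimple V k hh i f])).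

Arguments Lop {R d X M} V {H} k Hinf {l2} hh _.

Fixpoint fib (n : nat) : nat :=
  match n with 0 => 0 | 1 => 1 | (n'.+1 as m).+1 => (fib m + fib n')%N end.

Definition En (R : realType) (H : hilbertType R) (l2 : ell2 R)
    (hh : tensor_product l2 H) (n : nat) (f : H) : hh :=
  \sum_(i < n) ((fib i.+1)%:R : cplx R) *: tp hh (ell2_e l2 i) f.

Definition weight (R : realType) (tau p : R) (n : nat) : R :=
  expR (tau * (n%:R `^ p)).

(* The graph of D; the empty sequence gives D 1 = 0. *)
Definition Dgraph (R : realType) (h : hilbertType R)
    (T : forall n, tensor_power h n) (w : nat -> R) (F : fock T w)
    (dom : set h) (L : h -> h) : F -> F -> Prop :=
  lin_ext (fun eta zeta => exists v : seq h,
    [/\ (forall u, u \in v -> dom u),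
        eta = fvee F v &
        zeta = \sum_(i < size v) fvee F (set_nth 0 v i (L v`_i))]).

Arguments Dgraph {R h T w} F dom L _ _.

(* a is a_u^*, the bounded extension of eta |-> u \/ eta. *)
Definition creation (R : realType) (h : hilbertType R)
    (T : forall n, tensor_power h n) (w : nat -> R) (F : fock T w) (u : h)
    (a : F -> F) : Prop :=
  [/\ linear a, continuous a & forall v, a (fvee F v) = fvee F (u :: v)].

Definition adjoint (R : realType) (E : hilbertType R) (a b : E -> E) : Prop :=
  forall eta zeta, dot (a eta) zeta = dot eta (b zeta).

Definition annihilation (R : realType) (h : hilbertType R)
    (T : forall n, tensor_power h n) (w : nat -> R) (F : fock T w) (u : h)
    (a : F -> F) : Prop := exists2 b, creation u b & adjoint a b.

Inductive star_alg (R : realType) (E : hilbertType R) (G : set (E -> E)) :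
    set (E -> E) :=
| star_gen a : G a -> star_alg G a
| star_id : star_alg G id
| star_lin (c : cplx R) a b : star_alg G a -> star_alg G b ->
    star_alg G (fun eta => c *: a eta + b eta)
| star_mul a b : star_alg G a -> star_alg G b -> star_alg G (a \o b)
| star_adj a b : star_alg G a -> adjoint a b -> star_alg G b.

Definition An (R : realType) (H : hilbertType R) (S : set H) (l2 : ell2 R)
    (hh : tensor_product l2 H) (T : forall n, tensor_power hh n)
    (w : nat -> R) (F : fock T w) (n : nat) : set (F -> F) :=
  star_alg [set a | exists2 f, S f & annihilation (En hh n f) a].

Arguments An {R H} S {l2 hh T w} F n _ : rename.

Definition comm_norm (R : realType) (E : hilbertType R) (D : E -> E -> Prop)
    (a : E -> E) : \bar R :=
  ereal_sup [set r | exists eta Deta Daeta,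
    [/\ D eta Deta, D (a eta) Daeta, `|eta| <= 1 &
        r = (complex.Re `|Daeta - a Deta|)%:E]].

(* ell2_e l2 0 is the vector usually written e_1. *)
Definition Kvec (R : realType) (X : topologicalType) (H : hilbertType R)
    (k : X -> H) (l2 : ell2 R) (hh : tensor_product l2 H)
    (T : forall n, tensor_power hh n) (w : nat -> R) (F : fock T w)
    (x : X) (m : nat) : F :=
  lim ((\sum_(m <= j < N) ((w j ^+ 2)^-1)%:C *:
          fvee F (nseq j (tp hh (ell2_e l2 0) (k x)))) @[N --> \oo]).

Definition vec_state (R : realType) (E : hilbertType R) (K : E) (a : E -> E) :
  cplx R := dot K (a K) / `|K| ^+ 2.

Definition Psi (R : realType) (X : topologicalType) (H : hilbertType R)
    (k : X -> H) (l2 : ell2 R) (hh : tensor_product l2 H)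
    (T : forall n, tensor_power hh n) (w : nat -> R) (F : fock T w)
    (x : X) (a : F -> F) : cplx R :=
  lim (vec_state (Kvec k F x m) a @[m --> \oo]).

Arguments Psi {R X H} k {l2 hh T w} F x a.

Definition conn_dist (R : realType) (E : hilbertType R) (A : set (E -> E))
    (D : E -> E -> Prop) (phi psi : (E -> E) -> cplx R) : \bar R :=
  ereal_sup [set (complex.Re `|phi a - psi a|)%:E |
    a in [set a | A a /\ (comm_norm D a <= 1%:E)%E]].

(* Main.v *)
Require Import Defs.
From HB Require Import structures.
From mathcomp Require Import all_boot all_order all_algebra perm.
From mathcomp Require Import all_classical all_reals all_analysis.
From mathcomp Require Import complex.
From mathcomp Require Import ring lra.

Set Implicit Arguments.
Unset Strict Implicit.
Unset Printing Implicit Defensive.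

Import Order.TTheory GRing.Theory Num.Theory.
Import numFieldNormedType.Exports.

Local Open Scope classical_set_scope.
Local Open Scope ring_scope.

(* Write v_x = e_1 (x) k_x. Since w(n+1)/w(n) -> 1 and sum w(n)^(-2) < oo, the
   normalised vectors K_x^(m) are, as m grows, approximate eigenvectors of every
   annihilation operator a_u, with eigenvalue <u, v_x>, and also of every a_u^*,
   with eigenvalue <v_x, u>: the component of u orthogonal to v_x contributes
   to u \/ v_x^n only a norm of relative size 1/sqrt(n+1). Hence Psi_x is
   multiplicative on A_n and Psi_x(a) is a polynomial in the numbers
   <v_x, E_n f> = f(x) and their conjugates.

   As L is skew on H_0, [D, a_u^*] = a_(Lu)^* and [D, a_u] = a_(Lu) on the
   domain of D, so that [D, a] extends to a polynomial in such operators, and its value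
   at Psi_x is the derivative of t |-> Psi_(Phi^t x)(a) at 0: the Fibonacci
   numbers make <v_x, L E_n f> = ((F_2 S + F_1 A) f)(x) = (V f)(x). If
   ||[D, a]|| <= 1, this derivative is at most 1 in modulus, and the mean value
   theorem gives |Psi_x(a) - Psi_y(a)| <= |t| whenever x = Phi^t(y). *)

(** The approximation rests on a negligible boundary: the term of lowest degree carries a vanishing
    share of the norm of K_x^(m), so shifting by one degree changes the vector by a relatively small
    amount. Subexponential weights give this; for p = 1 the squared norms w(n)^(-2) would be
    geometric and the lowest term would keep a fixed share.

    The obstacle is the domain of D. The commutator norm tests only vectors of that domain, and an
    infinite sum K_x^(m) never lies in it; even k_x need not lie in [Hinf]. Each a in A_n is
    therefore paired with an operator bounded on the whole Fock space that equals [D, a] on the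
    domain; its bound by 1 passes to limits of vectors of the domain, among which are all the
    K_x^(m). As D is given by its graph, commutator identities are stated on the graph, and so
    include that a preserves the domain.

    The minimal time exists because the times leading from y to x form a closed set. *)

Definition nm (R : realType) (V : normedZmodType (cplx R)) (x : V) : R :=
  complex.Re `|x|.

(** * Inner products *)

Section InnerProduct.
Variables (R : realType) (H : hilbertType R).
Implicit Types (f g h : H) (a : cplx R).

Lemma dotJ f g : dot g f = (dot f g)^*.
Proof. exact: dotC. Qed.

Lemma dotDr f g h : dot f (g + h) = dot f g + dot f h.
Proof. by have := dot_linr f 1 g h; rewrite scale1r mul1r. Qed.

Lemma dot0r f : dot f 0 = 0.
Proof. by apply: (addrI (dot f 0)); rewrite -dotDr !addr0. Qed.

Lemma dotZr a f g : dot f (a *: g) = a * dot f g.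
Proof. by have := dot_linr f a g 0; rewrite !addr0 dot0r addr0. Qed.

Lemma dotNr f g : dot f (- g) = - dot f g.
Proof. by rewrite -scaleN1r dotZr mulN1r. Qed.

Lemma dotBr f g h : dot f (g - h) = dot f g - dot f h.
Proof. by rewrite dotDr dotNr. Qed.

Lemma dotDl f g h : dot (g + h) f = dot g f + dot h f.
Proof. by rewrite 3!(dotJ f) dotDr rmorphD. Qed.

Lemma dot0l f : dot 0 f = 0.
Proof. by rewrite dotJ dot0r rmorph0. Qed.

Lemma dotZl a f g : dot (a *: g) f = a^* * dot g f.
Proof. by rewrite 2!(dotJ f) dotZr rmorphM. Qed.

Lemma dotNl f g : dot (- g) f = - dot g f.
Proof. by rewrite 2!(dotJ f) dotNr rmorphN. Qed.

Lemma dotBl f g h : dot (g - h) f = dot g f - dot h f.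
Proof. by rewrite dotDl dotNl. Qed.

Lemma dot_sumr I (r : seq I) (P : pred I) f (g : I -> H) :
  dot f (\sum_(i <- r | P i) g i) = \sum_(i <- r | P i) dot f (g i).
Proof. exact: (big_morph (dot f) (dotDr f) (dot0r f)). Qed.

Lemma dot_suml I (r : seq I) (P : pred I) f (g : I -> H) :
  dot (\sum_(i <- r | P i) g i) f = \sum_(i <- r | P i) dot (g i) f.
Proof. exact: (big_morph (fun x => dot x f) (dotDl f) (dot0l f)). Qed.

Lemma dot_eq0 f : dot f f = 0 -> f = 0.
Proof. by rewrite dot_norm => /eqP; rewrite sqrf_eq0 normr_eq0 => /eqP. Qed.

(** Expansion of the squared norm of |g|^2 f - <g, f> g; scaling by |g|^2 instead of dividing keeps
    the computation polynomial. *)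
Lemma CauchySchwarz f g : `|dot f g| <= `|f| * `|g|.
Proof.
have [->|g0] := eqVneq g 0; first by rewrite dot0r !normr0 mulr0.
have ng : 0 < `|g| by rewrite normr_gt0.
have : 0 <= `|(`|g| ^+ 2) *: f - dot g f *: g| ^+ 2 by rewrite exprn_ge0.
rewrite -dot_norm !(dotBl, dotBr, dotZl, dotZr).
rewrite !dot_norm conj_Creal ?rpredX ?normr_real //.
rewrite (dotJ g f); set c := dot g f.
have -> : `|g| ^+ 2 * (`|g| ^+ 2 * `|f| ^+ 2) - c * (`|g| ^+ 2 * c^*) -
   c^* * (`|g| ^+ 2 * c - c * `|g| ^+ 2)
  = `|g| ^+ 2 * ((`|f| * `|g|) ^+ 2 - c * c^*) by ring.
rewrite pmulr_rge0 ?exprn_gt0 // subr_ge0 -normCK norm_conjC.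
by rewrite ler_pXn2r ?nnegrE ?mulr_ge0.
Qed.

End InnerProduct.

(** * Real-valued norms *)

Section RealNorm.
Variables (R : realType) (V : normedZmodType (cplx R)).
Implicit Types x y : V.

(** The norm of a module over [cplx R] is itself an element of [cplx R], real and nonnegative; its
    real part brings estimates back to the ordered field [R]. *)
Lemma nmE x : `|x| = ((nm x)%:C)%C.
Proof.
rewrite /nm; have : `|x| \is Num.real by exact: normr_real.
by case: `|x| => a b; rewrite complex_real /= => /eqP ->.
Qed.

Lemma nm_lt x (e : R) : (`|x| < (e%:C)%C) = (nm x < e).
Proof. by rewrite nmE ltcR. Qed.

Lemma nm_ge0 x : 0 <= nm x.
Proof. by rewrite -(@ler0c R) -nmE. Qed.

Lemma nm0 : nm (0 : V) = 0.
Proof. by rewrite /nm normr0. Qed.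

Lemma nmN x : nm (- x) = nm x.
Proof. by rewrite /nm normrN. Qed.

Lemma nmB x y : nm (x - y) = nm (y - x).
Proof. by rewrite /nm distrC. Qed.

Lemma nm_eq0 x : nm x = 0 -> x = 0.
Proof. by move=> x0; apply: normr0_eq0; rewrite nmE x0. Qed.

Lemma nmD x y : nm (x + y) <= nm x + nm y.
Proof. by rewrite -lecR rmorphD /= -!nmE ler_normD. Qed.

Lemma nmBD x y z : nm (x - z) <= nm (x - y) + nm (y - z).
Proof. by rewrite -[X in nm X](subrKA y) nmD. Qed.

Lemma nm_small x : (forall e : R, 0 < e -> nm x < e) -> x = 0.
Proof.
move=> h; apply: nm_eq0; apply/eqP; rewrite eq_le nm_ge0 andbT leNgt.
by apply/negP => /h; rewrite ltxx.
Qed.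

(** The form in which an identity |x|^2 = <x, y> is exploited: after Cauchy-Schwarz one factor |x|
    cancels. *)
Lemma nm_sqr_le x (c : R) : 0 <= c -> nm x ^+ 2 <= c * nm x -> nm x <= c.
Proof.
have [->|/eqP x0 _] := eqVneq (nm x) 0; first by [].
by rewrite expr2 ler_pM2r // lt_neqAle nm_ge0 eq_sym andbT; exact/eqP.
Qed.

End RealNorm.

Section RealNormTheory.
Variable R : realType.

Lemma nmZ (V : normedModType (cplx R)) (a : cplx R) (x : V) :
  nm (a *: x) = nm a * nm x.
Proof. by apply: (@complexI R); rewrite rmorphM /= -!nmE normrZ. Qed.

Lemma nmM (a b : cplx R) : nm (a * b) = nm a * nm b.
Proof. by apply: (@complexI R); rewrite rmorphM /= -!nmE normrM. Qed.

Lemma nm_conj (a : cplx R) : nm a^* = nm a.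
Proof. by rewrite /nm norm_conjC. Qed.

Lemma nmC (r : R) : nm ((r%:C)%C : cplx R) = `|r|.
Proof.
by rewrite /nm -[`|_|]/(`|(r%:C)%C : R[i]|) normc_def /= expr0n addr0 sqrtr_sqr.
Qed.

Lemma nm_dot (H : hilbertType R) (x y : H) : nm (dot x y) <= nm x * nm y.
Proof. by rewrite -lecR rmorphM /= -!nmE CauchySchwarz. Qed.

Lemma dot_nm (H : hilbertType R) (x : H) : dot x x = ((nm x ^+ 2)%:C)%C.
Proof. by rewrite rmorphXn /= -nmE dot_norm. Qed.

Lemma ReD (a b : cplx R) : complex.Re (a + b) = complex.Re a + complex.Re b.
Proof. by case: a b => [a a'] [b b']. Qed.

Lemma ReN (a : cplx R) : complex.Re (- a) = - complex.Re a.
Proof. by case: a. Qed.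

Lemma Re_le_nm (a : cplx R) : `|complex.Re a| <= nm a.
Proof. by rewrite -lecR -nmE; exact: normc_ge_Re. Qed.

(** Neighbourhoods are given by radii in [cplx R]; a positive element there is real, so real radii
    suffice. *)
Lemma cvg_nmP (V : normedModType (cplx R)) I (F : set_system I) {FF : Filter F}
    (f : I -> V) (l : V) :
  f @ F --> l <-> (forall e : R, 0 < e -> \forall i \near F, nm (l - f i) < e).
Proof.
split=> [/cvgrPdist_lt fl e e0|fl].
  have /fl : 0 < (e%:C)%C :> cplx R by rewrite -[0]/((0%:C)%C) ltcR.
  by apply: filterS => i; rewrite nm_lt.
apply/cvgrPdist_lt => e e0.
have eE : e = ((complex.Re e)%:C)%C by rewrite RRe_real // gtr0_real.
have : 0 < complex.Re e by rewrite -ltcR -eE.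
by move=> /fl; apply: filterS => i; rewrite eE nm_lt.
Qed.

(** * Completeness, density and extension by continuity *)

Lemma nm_cauchy_cvg (V : completeNormedModType (cplx R)) (u : nat -> V) :
  (forall e : R, 0 < e -> exists N, forall m n, (N <= m)%N -> (N <= n)%N ->
     nm (u m - u n) < e) -> cvgn u.
Proof.
move=> hu; apply/cauchy_cvgP/cauchy_ballP => e e0.
have eE : e = ((complex.Re e)%:C)%C by rewrite RRe_real // gtr0_real.
have /hu[N hN] : 0 < complex.Re e by rewrite -ltcR -eE.
exists (u @` [set n | (N <= n)%N], u @` [set n | (N <= n)%N]); last first.
  by move=> [_ _] [[m /= Nm <-] [n /= Nn <-]];
    rewrite -ball_normE /= eE nm_lt hN.
by split; apply: filterS (nbhs_infty_ge N) => n Nn; exists n.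
Qed.

(** Membership in the closure, at a single point and with real radii, so that it can be propagated
    through linear combinations. *)
Definition approx (V : normedModType (cplx R)) (A : set V) (x : V) : Prop :=
  forall e : R, 0 < e -> exists2 a, A a & nm (x - a) < e.

Lemma dense_approx (V : normedModType (cplx R)) (A : set V) (x : V) :
  dense A -> approx A x.
Proof.
move=> dA e e0.
have E0 : 0 < (e%:C)%C :> cplx R by rewrite -[0]/((0%:C)%C) ltcR.
have xB := nbhsx_ballx x _ E0.
have [||a [aB aA]] := dA (interior (ball x (e%:C)%C)).
- by exists x; exact: nbhs_singleton (nbhs_interior xB).
- exact: open_interior.
by exists a => //; move: (interior_subset aB); rewrite -ball_normE /= nm_lt.
Qed.

Definition bounded_op (E F : hilbertType R) (a : E -> F) : Prop :=
  linear a /\ exists2 C : R, 0 <= C & forall x, nm (a x) <= C * nm x.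

Lemma lin_ext_lin (E : hilbertType R) (G : E -> E -> Prop) (a : cplx R)
    u v u' v' :
  lin_ext G u v -> lin_ext G u' v' -> lin_ext G (a *: u + u') (a *: v + v').
Proof.
move=> uv uv'; elim: uv => [|b x y x' y' xy _ ih].
  by rewrite !scaler0 !add0r.
by rewrite !scalerDr !scalerA -!addrA; exact: lin_extD.
Qed.

Lemma lin_ext_dom (E : hilbertType R) (G : E -> E -> Prop) :
  op_dom (lin_ext G) = Defs.span (op_dom G).
Proof.
apply/seteqP; split=> u.
  case=> v; elim=> [|a x y x' y' xy _ ih]; first exact: span0.
  by apply: spanD => //; exists y.
elim=> [|a x y [x' xx'] _ [y' yy']]; first by exists 0; exact: lin_ext0.
by exists (a *: x' + y'); exact: lin_extD.
Qed.

Lemma linear_spec (E F : lmodType (cplx R)) (f : E -> F) : linear f ->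
  [/\ f 0 = 0, {morph f : x y / x + y}, {morph f : x y / x - y} &
   forall c x, f (c *: x) = c *: f x].
Proof.
move=> lf; have f0 : f 0 = 0.
  by have := lf (-1) 0 0; rewrite !scaleN1r !addNr.
split=> // [x y|x y|c x].
- by have := lf 1 x y; rewrite !scale1r.
- by have := lf (-1) y x; rewrite !scaleN1r [- y + x]addrC [- f y + f x]addrC.
- by have := lf c x 0; rewrite f0 !addr0.
Qed.

Lemma linear_sumP (E F : lmodType (cplx R)) (f : E -> F) : linear f ->
  forall I (r : seq I) (P : pred I) (x : I -> E),
  f (\sum_(i <- r | P i) x i) = \sum_(i <- r | P i) f (x i).
Proof. by move=> /linear_spec[f0 fD _ _] I r P x;
  exact: (big_morph f fD f0). Qed.

Lemma lin_extZ (E : hilbertType R) (G : E -> E -> Prop) (c : cplx R) u v :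
  lin_ext G u v -> lin_ext G (c *: u) (c *: v).
Proof.
by rewrite -[c *: u]addr0 -[c *: v]addr0 => uv; exact: lin_ext_lin (lin_ext0 _).
Qed.

Lemma lin_ext_gen (E : hilbertType R) (G : E -> E -> Prop) u v :
  G u v -> lin_ext G u v.
Proof.
move=> Guv; rewrite -[u]scale1r -[v]scale1r -[1 *: u]addr0 -[1 *: v]addr0.
exact: lin_extD (lin_ext0 _).
Qed.

(** The relation is not assumed single-valued: the bound at [u = 0] forces this. [Gb] is the closure
    of the graph. The bound persists on it and makes it a function; completeness makes it total,
    since the images of approximants of [x] form a Cauchy sequence. *)
Lemma bounded_extension (E : hilbertType R) (G : E -> E -> Prop) (C : R) :
  0 <= C -> (forall x, approx (op_dom (lin_ext G)) x) ->
  (forall u v, lin_ext G u v -> nm v <= C * nm u) ->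
  exists a : E -> E, [/\ linear a, forall x, nm (a x) <= C * nm x &
    forall u v, lin_ext G u v -> a u = v].
Proof.
move=> C0 dG bG.
pose Gb x y := forall e : R, 0 < e ->
  exists u v, [/\ lin_ext G u v, nm (x - u) < e & nm (y - v) < e].
have Gb_sub u v : lin_ext G u v -> Gb u v.
  by move=> uv e e0; exists u, v; rewrite !subrr !nm0.
have Gb_bound x y : Gb x y -> nm y <= C * nm x.
  move=> xy; apply/ler_addgt0Pl => e e0.
  (* An error d in both argument and value costs d + C d in all; C + 1 is positive even when C =
     0. *)
  have eE : e = e / (C + 1) + C * (e / (C + 1)) by field; lra.
  have : 0 < e / (C + 1) by apply: divr_gt0 => //; lra.
  move: (e / _) eE => d eE d0.
  have [u [v [uv xu yv]]] := xy _ d0.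
  have := nmD (y - v) v; rewrite subrK => h1.
  have := nmD (u - x) x; rewrite subrK nmB => h2.
  have h3 := bG _ _ uv.
  have : C * nm u <= C * (d + nm x) by apply: ler_wpM2l => //; lra.
  by rewrite mulrDr; lra.
have Gb_lin a x y x' y' : Gb x y -> Gb x' y' ->
    Gb (a *: x + x') (a *: y + y').
  move=> xy xy' e e0.
  have a1 : 0 < nm a + 1 by have := nm_ge0 a; lra.
  have d0 : 0 < e / (nm a + 1) / 2 by rewrite !divr_gt0.
  have [u [v [uv xu yv]]] := xy _ d0.
  have [u' [v' [uv' xu' yv']]] := xy' _ d0.
  exists (a *: u + u'), (a *: v + v').
  have bnd (p q p' q' : E) : nm (p - q) < e / (nm a + 1) / 2 ->
      nm (p' - q') < e / (nm a + 1) / 2 ->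
      nm (a *: p + p' - (a *: q + q')) < e.
    move=> pq pq'; rewrite opprD addrACA -scalerBr.
    apply: (le_lt_trans (nmD _ _)); rewrite nmZ.
    have : nm a * nm (p - q) <= nm a * (e / (nm a + 1) / 2).
      by rewrite ler_wpM2l ?nm_ge0 // ltW.
    have : e = (nm a + 1) * (e / (nm a + 1) / 2) * 2.
      by field; rewrite gt_eqF.
    by rewrite !mulrDl mul1r; lra.
  by split; [exact: lin_ext_lin|exact: bnd|exact: bnd].
have Gb_fun x y y' : Gb x y -> Gb x y' -> y = y'.
  move=> xy xy'; apply/eqP; rewrite -subr_eq0; apply/eqP.
  have := Gb_lin (-1) _ _ _ _ xy' xy; rewrite !scaleN1r addNr addrC.
  move=> /Gb_bound; rewrite nm0 mulr0 => h.
  by apply: nm_eq0; apply/eqP; rewrite eq_le h nm_ge0.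
have Gb_tot x : exists y, Gb x y.
  have h (j : nat) : exists uv : E * E,
      lin_ext G uv.1 uv.2 /\ nm (x - uv.1) < j.+1%:R^-1.
    have j0 : 0 < j.+1%:R^-1 :> R by rewrite invr_gt0 ltr0n.
    have [u [v uv] xu] := dG x _ j0.
    by exists (u, v).
  have [uv huv] := choice h.
  have cy : cvgn (fun j => (uv j).2).
    apply: nm_cauchy_cvg => e e0.
    have eE : e = (e / (C + 1) / 2) * 2 + C * ((e / (C + 1) / 2) * 2).
      by field; lra.
    have d0 : 0 < e / (C + 1) / 2 by rewrite !divr_gt0 //; lra.
    move: (e / _ / _) eE d0 => d eE d0.
    have [N _ hN] := near_infty_natSinv_lt (PosNum d0).
    exists N => m n Nm Nn.
    have [gm um] := huv m; have [gn un] := huv n.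
    have := lin_ext_lin (-1) gn gm; rewrite !scaleN1r !(addrC (- _)).
    move=> /bG h1; apply: (le_lt_trans h1).
    have h2 := nmBD (uv m).1 x (uv n).1.
    have h3 := lt_trans um (hN m Nm); have h4 := lt_trans un (hN n Nn).
    rewrite /= in h3 h4.
    rewrite (nmB _ x) in h2.
    have : C * nm ((uv m).1 - (uv n).1) <= C * (d * 2).
      by rewrite ler_wpM2l //; lra.
    by lra.
  exists (limn (fun j => (uv j).2)) => e e0.
  have [N1 _ h1] := (cvg_nmP _ _).1 cy e e0.
  have [N2 _ h2] := near_infty_natSinv_lt (PosNum e0).
  pose j := maxn N1 N2.
  exists (uv j).1, (uv j).2; have [g1 g2] := huv j; split=> //.
    by apply: (lt_trans g2); exact: (h2 j (leq_maxr _ _)).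
  exact: (h1 j (leq_maxl _ _)).
have [a ha] := choice Gb_tot.
exists a; split=> [c x y|x|u v uv].
- exact: Gb_fun (ha _) (Gb_lin c _ _ _ _ (ha x) (ha y)).
- exact: Gb_bound.
- exact: Gb_fun (ha u) (Gb_sub _ _ uv).
Qed.

Section Approximation.
Variable E : hilbertType R.
Implicit Types (A B : set E) (x y : E).

Lemma span_lin A (c : cplx R) x y :
  Defs.span A x -> Defs.span A y -> Defs.span A (c *: x + y).
Proof.
move=> Ax Ay; elim: Ax => [|b u v Au _ ih]; first by rewrite scaler0 add0r.
by rewrite scalerDr scalerA -addrA; exact: spanD.
Qed.

Lemma span_gen A x : A x -> Defs.span A x.
Proof. by move=> Ax; rewrite -[x]scale1r -[_ *: _]addr0; apply/spanD/span0. Qed.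

Lemma approx_sub A x : A x -> approx A x.
Proof. by move=> Ax e e0; exists x => //; rewrite subrr nm0. Qed.

Lemma approx_lin A (c : cplx R) x y :
  approx (Defs.span A) x -> approx (Defs.span A) y ->
  approx (Defs.span A) (c *: x + y).
Proof.
move=> ax ay e e0.
have c1 : 0 < nm c + 1 by have := nm_ge0 c; lra.
have eE : e = (nm c + 1) * (e / (nm c + 1) / 2) * 2 by field; rewrite gt_eqF.
have : 0 < e / (nm c + 1) / 2 by rewrite !divr_gt0.
move: (e / _ / _) eE => d eE d0.
have [u Au xu] := ax _ d0; have [v Av yv] := ay _ d0.
exists (c *: u + v); first exact: span_lin.
rewrite opprD addrACA -scalerBr; apply: (le_lt_trans (nmD _ _)); rewrite nmZ.
have : nm c * nm (x - u) <= nm c * d by rewrite ler_wpM2l ?nm_ge0 // ltW.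
by rewrite eE !mulrDl mul1r; lra.
Qed.

Lemma approx_approx A x : approx (approx A) x -> approx A x.
Proof.
move=> ax e e0; have e20 : 0 < e / 2 by rewrite divr_gt0.
have [y ay xy] := ax _ e20; have [z az yz] := ay _ e20.
by exists z => //; have := nmBD x y z; lra.
Qed.

Lemma approx_span A B x : (forall b, B b -> approx (Defs.span A) b) ->
  approx (Defs.span B) x -> approx (Defs.span A) x.
Proof.
move=> BA aB; apply: approx_approx => e /aB[y yB xy]; exists y => //.
elim: yB => [|c u v /BA Bu _ ih]; first exact/approx_sub/span0.
exact: approx_lin.
Qed.

(** Through this, identities between bounded maps on Fock space are reduced to products of
    vectors. *)
Lemma linear_approx_eq0 A (V : normedModType (cplx R)) (f : E -> V) (C : R) :
  linear f -> (forall x, nm (f x) <= C * nm x) ->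
  (forall x, A x -> f x = 0) -> forall x, approx (Defs.span A) x -> f x = 0.
Proof.
move=> lf bf fA x ax; have [f0 _ fB _] := linear_spec lf;
  apply: nm_small => e e0.
have C1 : 0 < `|C| + 1 by have := normr_ge0 C; lra.
have d0 : 0 < e / (`|C| + 1) by rewrite divr_gt0.
have [y yA xy] := ax _ d0.
have fy : f y = 0.
  by elim: yA => [//|c u v /fA fu _ ih]; rewrite lf fu ih scaler0 addr0.
rewrite -[f x]subr0 -fy -fB; apply: (le_lt_trans (bf _)).
rewrite ltr_pdivlMr // in xy; apply: (le_lt_trans _ xy).
rewrite mulrC ler_wpM2l ?nm_ge0 //; have := ler_norm C; lra.
Qed.

Lemma approx_ortho A x : (forall y, A y -> dot y x = 0) ->
  approx (Defs.span A) x -> x = 0.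
Proof.
move=> Ax ax; apply: dot_eq0.
apply: (@linear_approx_eq0 A (cplx R) (dot x) (nm x)) => // [c y z|y|y /Ax xy].
- by rewrite dotDr dotZr.
- exact: nm_dot.
- by rewrite dotJ xy rmorph0.
Qed.

Lemma pythagoras (I : eqType) (r : seq I) (x : I -> E) :
  uniq r -> (forall i j, i != j -> dot (x i) (x j) = 0) ->
  nm (\sum_(i <- r) x i) ^+ 2 = \sum_(i <- r) nm (x i) ^+ 2.
Proof.
move=> ur ox; apply: (@complexI R); rewrite -dot_nm.
elim: r ur => [|i r ih] /=; first by rewrite !big_nil dot0l.
move=> /andP[ir ur]; rewrite !big_cons rmorphD /= -ih // -dot_nm.
set S := (X in x i + X); have o : dot (x i) S = 0.
  rewrite /S dot_sumr big_seq big1 // => j jr; apply: ox.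
  by apply: contraNneq ir => ->.
by rewrite dotDl !dotDr (dotJ (x i) S) o rmorph0 addr0 add0r.
Qed.

End Approximation.

End RealNormTheory.

(** * Symmetric tensors in Fock space *)

Section FockSpace.
Variables (R : realType) (h : hilbertType R).
Variable T : forall n, tensor_power h n.
Variables (w : nat -> R) (F : fock T w).
Hypothesis w_gt0 : forall n, 0 < w n.

(** The type of [vee T v] depends on the list [v] through its size; indexing by ['I_n] fixes the
    degree and lets permutations act directly on indices. *)
Definition tvee n (v : 'I_n -> h) : T n :=
  ((n`!%:R : cplx R)^-1) *: \sum_(s : 'S_n) tens (T n) (fun i => v (s i)).

Definition ffvee n (v : 'I_n -> h) : F := fock_in F n (tvee v).

Lemma ffvee_seq (s : seq h) n : size s = n ->
  ffvee (fun i : 'I_n => s`_i) = fvee F s.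
Proof. by move=> <-. Qed.

Lemma ffvee_of_seq n (v : 'I_n -> h) :
  exists s : seq h, [/\ size s = n, (forall i : 'I_n, s`_i = v i) &
    ffvee v = fvee F s].
Proof.
pose s := [seq v i | i <- enum 'I_n].
have ss : size s = n by rewrite size_map size_enum_ord.
have sv (i : 'I_n) : s`_i = v i.
  by rewrite (nth_map i) ?size_enum_ord // nth_ord_enum.
by exists s; split=> //; rewrite -(ffvee_seq ss); congr ffvee; apply/funext.
Qed.

Lemma dot_tens_tvee n (v v' : 'I_n -> h) : dot (tens (T n) v') (tvee v) =
  (n`!%:R)^-1 * \sum_(s : 'S_n) \prod_i dot (v' i) (v (s i)).
Proof.
rewrite /tvee dotZr dot_sumr; congr (_ * _).
by apply: eq_bigr => s _; rewrite tens_dot.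
Qed.

(** Left translation of the summation variable by the inverse of the given permutation absorbs
    it. *)
Lemma tvee_sym n (v : 'I_n -> h) : symmetric_tensor (tvee v).
Proof.
move=> s0 v'; rewrite !dot_tens_tvee; congr (_ * _).
rewrite [RHS](reindex_inj (mulgI s0^-1%g)) /=; apply: eq_bigr => s _.
rewrite [RHS](reindex_inj (@perm_inj _ s0)) /=.
by apply: eq_bigr => i _; rewrite permM permK.
Qed.

(** All n! permuted terms have the same inner product with [t]: symmetrisation is the orthogonal
    projection onto symmetric tensors. *)
Lemma dot_tvee_sym n (v : 'I_n -> h) (t : T n) :
  symmetric_tensor t -> dot (tvee v) t = dot (tens (T n) v) t.
Proof.
move=> st; rewrite /tvee dotZl dot_suml conj_Creal ?rpredV ?realn //.
rewrite (eq_bigr (fun=> dot (tens (T n) v) t)) => [|s _]; last exact: st.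
rewrite sumr_const card_Sn -[dot _ _ *+ _]mulr_natl mulrA mulVf ?mul1r //
  pnatr_eq0 -lt0n fact_gt0.
Qed.

Lemma sym_lin n (a : cplx R) (s t : T n) : symmetric_tensor s ->
  symmetric_tensor t -> symmetric_tensor (a *: s + t).
Proof. by move=> ss st p v; rewrite !dotDr !dotZr ss st. Qed.

(** The sum over permutations is the permanent of the matrix of inner products of the factors. *)
Lemma dot_ffvee n (v v' : 'I_n -> h) : dot (ffvee v) (ffvee v') =
  ((w n ^+ 2)%:C)%C * ((n`!%:R)^-1 *
  \sum_(s : 'S_n) \prod_i dot (v i) (v' (s i))).
Proof.
rewrite fock_in_dot; [|exact: tvee_sym..].
by rewrite dot_tvee_sym ?dot_tens_tvee //; exact: tvee_sym.
Qed.

Lemma dot_ffvee_neq m n (v : 'I_m -> h) (v' : 'I_n -> h) :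
  m != n -> dot (ffvee v) (ffvee v') = 0.
Proof. by move=> mn; apply: fock_in_orth => //; exact: tvee_sym. Qed.

Lemma nm_fock_in n (t : T n) : symmetric_tensor t ->
  nm (fock_in F n t) = w n * nm t.
Proof.
move=> st; have := dot_nm (fock_in F n t).
rewrite fock_in_dot // dot_nm -rmorphM -exprMn => /(@complexI R)/esym/eqP.
by rewrite eqrXn2 ?nm_ge0 ?mulr_ge0 ?nm_ge0 ?(ltW (w_gt0 n)) // => /eqP.
Qed.

(* Symmetrising an approximation by elementary tensors does not increase the
   distance to a symmetric tensor. *)
Lemma approx_sym n (t : T n) : symmetric_tensor t ->
  approx (Defs.span (range (fvee F))) (fock_in F n t).
Proof.
move=> st e e0; have d0 : 0 < e / w n by rewrite divr_gt0.
have [u uS tu] := dense_approx t (@tens_dense _ _ _ (T n)) d0.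
(* [s] is the symmetrisation of [u], built term by term along the span and recorded only through its
   inner products with symmetric tensors. *)
have [s [ss sF su]] : exists s : T n, [/\ symmetric_tensor s,
    Defs.span (range (fvee F)) (fock_in F n s) &
    forall t', symmetric_tensor t' -> dot t' s = dot t' u].
  elim: uS {tu} => [|a _ y [v _ <-] _ [s [ss sF sy]]].
    have s0 : symmetric_tensor (0 : T n) by move=> p v; rewrite !dot0r.
    exists 0; split=> //; rewrite -[0 : T n]addr0 -[X in X + 0](scale0r 0).
    rewrite fock_in_lin // scale0r add0r.
    have -> : fock_in F n 0 = 0; last exact: span0.
    by apply: nm_eq0; rewrite nm_fock_in // nm0 mulr0.
  exists (a *: tvee v + s); split.
  - by apply: sym_lin => //; exact: tvee_sym.
  - rewrite fock_in_lin //; last exact: tvee_sym.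
    apply: spanD => //; have [q [_ _ qE]] := ffvee_of_seq v.
    by exists q.
  - move=> t' st'; rewrite 2!dotDr sy // 2!(dotZr a); congr (_ * _ + _).
    by rewrite dotJ dot_tvee_sym // -dotJ.
exists (fock_in F n s) => //.
have tsE : fock_in F n t - fock_in F n s = fock_in F n (t - s).
  have := fock_in_lin F (-1) ss st; rewrite !scaleN1r [- s + t]addrC => ->.
  by rewrite [RHS]addrC.
have sts : symmetric_tensor (t - s).
  by have := sym_lin (-1) ss st; rewrite scaleN1r [- s + t]addrC.
rewrite tsE nm_fock_in // mulrC -ltr_pdivlMr //; apply: le_lt_trans tu.
(* As t - s is symmetric, <t - s, t - u> = <t - s, t - s>. *)
apply: nm_sqr_le; rewrite ?nm_ge0 // mulrC; apply: le_trans (nm_dot _ _).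
have -> : dot (t - s) (t - u) = dot (t - s) (t - s).
  by rewrite !(dotBr (t - s)) su.
by rewrite dot_nm nmC ler_norm.
Qed.

Lemma approx_fvee (x : F) : approx (Defs.span (range (fvee F))) x.
Proof.
apply: approx_span (dense_approx _ (@fock_dense _ _ _ _ F)) => _ [n [t st ->]].
exact: approx_sym.
Qed.

End FockSpace.

Arguments tvee {R h} T {n} v.
Arguments ffvee {R h T w} F {n} v.

(** * Expansion of permanents *)

Lemma lift_perm_surj n (j : 'I_n.+1) (s : 'S_n.+1) :
  s ord0 = j -> exists s', lift_perm ord0 j s' = s.
Proof.
move=> s0; have /choice[f hf] k : exists k', s (lift ord0 k) = lift j k'.
  have : j != s (lift ord0 k) by rewrite -s0 (inj_eq perm_inj) neq_lift.
  by move=> /unlift_some[k' sk _]; exists k'.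
have f_inj : injective f.
  move=> a b fab; apply: (@lift_inj _ ord0); apply: (@perm_inj _ s).
  by rewrite !hf fab.
exists (perm f_inj); apply/permP => i; case: (unliftP ord0 i) => [k|] ->.
  by rewrite lift_perm_lift permE hf.
by rewrite lift_perm_id s0.
Qed.

(** Laplace expansion along the first row, without signs: permutations are sorted by the image [j]
    of 0, and [lift_perm ord0 j] parametrises those with a given [j]. *)
Lemma expand_permanent (K : comNzRingType) n (M : 'I_n.+1 -> 'I_n.+1 -> K) :
  \sum_(s : 'S_n.+1) \prod_i M i (s i) =
  \sum_j M ord0 j *
    \sum_(s : 'S_n) \prod_i M (lift ord0 i) (lift j (s i)).
Proof.
rewrite (partition_big (fun s : 'S_n.+1 => s ord0) xpredT) //=.
apply: eq_bigr => j _; rewrite mulr_sumr.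
rewrite (reindex (lift_perm ord0 j)); last first.
  (* An inverse of [lift_perm ord0 j]; the default 1 is never reached on permutations sending 0 to
     [j]. *)
  pose g s := odflt 1%g [pick s' | lift_perm ord0 j s' == s].
  have inj : injective (lift_perm ord0 j).
    move=> s s' /permP ss'; apply/permP => k; apply: (@lift_inj _ j).
    by have := ss' (lift ord0 k); rewrite !lift_perm_lift.
  exists g => s; rewrite /g.
    by move=> _; case: pickP => [s' /eqP/inj //|/(_ s)]; rewrite eqxx.
  rewrite inE => /eqP/lift_perm_surj[s' <-].
  by case: pickP => [s'' /eqP //|/(_ s')]; rewrite eqxx.
apply: eq_big => [s|s _]; first by rewrite lift_perm_id eqxx.
rewrite big_ord_recl lift_perm_id; congr (_ * _).
by apply: eq_bigr => i _; rewrite lift_perm_lift.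
Qed.

Definition ucons (V : Type) n (u : V) (v : 'I_n -> V) (i : 'I_n.+1) : V :=
  if unlift ord0 i is Some j then v j else u.

Lemma ucons0 (V : Type) n (u : V) (v : 'I_n -> V) : ucons u v ord0 = u.
Proof. by rewrite /ucons unlift_none. Qed.

Lemma uconsS (V : Type) n (u : V) (v : 'I_n -> V) j :
  ucons u v (lift ord0 j) = v j.
Proof. by rewrite /ucons liftK. Qed.

(** * Creation operators *)

Section Creation.
Variables (R : realType) (h : hilbertType R).
Variable T : forall n, tensor_power h n.
Variables (w : nat -> R) (F : fock T w).
Hypothesis w_gt0 : forall n, 0 < w n.

Lemma ffvee_ucons u (s : seq h) n : size s = n ->
  fvee F (u :: s) = ffvee F (ucons u (fun i : 'I_n => s`_i)).
Proof.
move=> sn; rewrite -(@ffvee_seq _ _ _ _ _ _ n.+1) /= ?sn //.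
congr (ffvee F); apply/funext => i; case: (unliftP ord0 i) => [j|] ->.
  by rewrite uconsS.
by rewrite ucons0.
Qed.

Lemma sym_sum n I (r : seq I) (c : I -> cplx R) (t : I -> T n) :
  (forall i, symmetric_tensor (t i)) ->
  symmetric_tensor (\sum_(i <- r) c i *: t i) /\
  fock_in F n (\sum_(i <- r) c i *: t i) = \sum_(i <- r) c i *: fock_in F n (t
    i).
Proof.
move=> st; elim: r => [|i r [ih1 ih2]].
  have s0 : symmetric_tensor (0 : T n) by move=> p v; rewrite !dot0r.
  rewrite !big_nil; split=> //.
  by apply: nm_eq0; rewrite nm_fock_in // nm0 mulr0.
rewrite !big_cons -ih2; split; first exact: sym_lin.
exact: fock_in_lin.
Qed.

Lemma dot_tens_ucons n u u' (v v' : 'I_n -> h) :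
  dot (tens (T n.+1) (ucons u v)) (tens (T n.+1) (ucons u' v')) =
  dot u u' * dot (tens (T n) v) (tens (T n) v').
Proof.
rewrite !tens_dot big_ord_recl !ucons0; congr (_ * _).
by apply: eq_bigr => i _; rewrite !uconsS.
Qed.

(** A permutation of the last n factors is one of all n + 1 factors that fixes the first, hence
    invisible to a symmetric [t]. *)
Lemma tens_ucons_perm n u (v : 'I_n -> h) (s : 'S_n) (t : T n.+1) :
  symmetric_tensor t ->
  dot t (tens (T n.+1) (ucons u (fun i => v (s i)))) =
  dot t (tens (T n.+1) (ucons u v)).
Proof.
move=> st; rewrite dotJ [RHS]dotJ -[in RHS](st (lift_perm ord0 ord0 s)).
congr ((dot (tens _ _) _)^*); apply/funext => i.
case: (unliftP ord0 i) => [j|] ->.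
  by rewrite lift_perm_lift !uconsS.
by rewrite lift_perm_id !ucons0.
Qed.

(* Symmetrising is a projection: the norm of u \/ eta is at most that of
   [tau] = u (x) eta, which is |u| |eta|. *)
Lemma creation_degree n I (r : seq I) (c : I -> cplx R) (v : I -> 'I_n -> h) u :
  nm (\sum_(i <- r) c i *: ffvee F (ucons u (v i))) * w n <=
  w n.+1 * (nm u * nm (\sum_(i <- r) c i *: ffvee F (v i))).
Proof.
have [sZ <-] := sym_sum r c (fun i => tvee_sym T (ucons u (v i))).
have [sW <-] := sym_sum r c (fun i => tvee_sym T (v i)).
rewrite !nm_fock_in //.
have -> : w n.+1 * (nm u * (w n * nm (\sum_(i <- r) c i *: tvee T (v i)))) =
  w n.+1 * (nm u * nm (\sum_(i <- r) c i *: tvee T (v i))) * w n by ring.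
rewrite ler_pM2r // ler_pM2l //.
pose b i := c i * (n`!%:R)^-1.
pose tau := \sum_(i <- r) \sum_(s : 'S_n)
  b i *: tens (T n.+1) (ucons u (fun j => v i (s j))).
set Z := (X in nm X <= _).
set W := (X in nm u * nm X).
have ZW : W =
    \sum_(i <- r) \sum_(s : 'S_n) b i *: tens (T n) (fun j => v i (s j)).
  apply: eq_bigr => i _; rewrite /tvee scalerA -/(b i).
  by rewrite scaler_sumr.
have tauW : nm tau = nm u * nm W.
  apply/eqP; rewrite -(@eqrXn2 _ 2) ?nm_ge0 ?mulr_ge0 ?nm_ge0 //; apply/eqP.
  apply: (@complexI R); rewrite exprMn [RHS]rmorphM /= -!dot_nm ZW /tau.
  rewrite !dot_suml mulr_sumr; apply: eq_bigr => i _.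
  rewrite !dot_suml mulr_sumr; apply: eq_bigr => s _.
  rewrite !dot_sumr mulr_sumr; apply: eq_bigr => i' _.
  rewrite !dot_sumr mulr_sumr; apply: eq_bigr => s' _.
  by rewrite !dotZl !dotZr dot_tens_ucons; ring.
have Ztau : dot Z Z = dot Z tau.
  rewrite {2}/Z /tau !dot_sumr; apply: eq_bigr => i _.
  rewrite dot_sumr dotZr [dot Z _]dotJ dot_tvee_sym // -dotJ.
  under eq_bigr do rewrite dotZr tens_ucons_perm //.
  rewrite sumr_const card_Sn /b -mulrnAl -mulrnAr.
  by rewrite -[_ *+ _]mulr_natr mulVf ?mulr1 // pnatr_eq0 -lt0n fact_gt0.
rewrite -tauW; apply: nm_sqr_le; rewrite ?nm_ge0 // mulrC.
by apply: le_trans (nm_dot _ _); rewrite -Ztau dot_nm nmC ler_norm.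
Qed.

End Creation.

Lemma linear_continuous_bounded (R : realType) (E F : hilbertType R)
    (a : E -> F) : linear a -> continuous a -> bounded_op a.
Proof.
move=> la ca; split=> //.
pose aL := HB.pack_for {linear E -> F} a (GRing.isLinear.Build _ _ _ _ _ la).
have /linear_boundedP/pinfty_ex_gt0[c c0 ac] :=
  @continuous_linear_bounded _ _ _ 0 aL (ca 0).
have cE : c = ((complex.Re c)%:C)%C by rewrite RRe_real // gtr0_real.
exists (complex.Re c); first by rewrite -(@ler0c R) -cE ltW.
by move=> x; rewrite -lecR rmorphM /= -!nmE -cE; exact: ac.
Qed.

Section CreationAnnihilation.
Variables (R : realType) (h : hilbertType R).
Variable T : forall n, tensor_power h n.
Variables (w : nat -> R) (F : fock T w) (Cw : R).
Hypothesis w_gt0 : forall n, 0 < w n.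
Hypothesis w_growth : forall n, w n.+1 <= Cw * w n.

Lemma growth_ge0 : 0 <= Cw.
Proof.
have := le_trans (ltW (w_gt0 1)) (w_growth 0).
by rewrite pmulr_lge0.
Qed.

(* Here the domain is spanned by products of all degrees; they are sorted by
   degree and estimated one degree at a time. *)
Lemma creation_bound u (eta zeta : F) :
  lin_ext (fun x y => exists s, x = fvee F s /\ y = fvee F (u :: s)) eta zeta ->
  nm zeta <= Cw * nm u * nm eta.
Proof.
move=> H.
have [r [-> ->]] : exists r : seq (cplx R * seq h),
    eta = \sum_(x <- r) x.1 *: fvee F x.2 /\
    zeta = \sum_(x <- r) x.1 *: fvee F (u :: x.2).
  elim: H => [|a _ _ x' y' [s [-> ->]] _ [r [-> ->]]].
    by exists [::]; rewrite !big_nil.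
  by exists ((a, s) :: r); rewrite !big_cons.
pose B := (\max_(x <- r) size x.2).+1.
have split_size (f : cplx R * seq h -> F) : \sum_(x <- r) f x =
    \sum_(n <- iota 0 B) \sum_(x <- r | size x.2 == n) f x.
  rewrite (exchange_big_dep xpredT) //=; apply: eq_big_seq => x xr.
  have xB : size x.2 \in iota 0 B.
    rewrite mem_iota add0n ltnS /=.
    exact: (@leq_bigmax_seq _ r xpredT (fun x => size x.2) x xr).
  rewrite -big_filter.
  have -> : [seq n <- iota 0 B | size x.2 == n] = [:: size x.2].
    rewrite -(filter_pred1_uniq (iota_uniq 0 B) xB).
    by apply: eq_filter => n; rewrite /= eq_sym.
  by rewrite big_seq1.
rewrite 2!split_size.
set ex := fun n : nat => \sum_(x <- r | size x.2 == n) x.1 *: fvee F x.2.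
set zx := fun n : nat => \sum_(x <- r | size x.2 == n) x.1 *: fvee F (u :: x.2).
rewrite -[X in nm X <= _]/(\sum_(n <- iota 0 B) zx n).
rewrite -[X in _ <= _ * nm X]/(\sum_(n <- iota 0 B) ex n).
have exE n : ex n = \sum_(x <- [seq x <- r | size x.2 == n])
    x.1 *: ffvee F (fun i : 'I_n => x.2`_i).
  rewrite /ex -big_filter; apply: eq_big_seq => x; rewrite mem_filter.
  by move=> /andP[/eqP sx _]; rewrite (ffvee_seq _ sx).
have zxE n : zx n = \sum_(x <- [seq x <- r | size x.2 == n])
    x.1 *: ffvee F (ucons u (fun i : 'I_n => x.2`_i)).
  rewrite /zx -big_filter; apply: eq_big_seq => x; rewrite mem_filter.
  by move=> /andP[/eqP sx _]; rewrite (ffvee_ucons _ _ sx).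
have ex_ortho m n : m != n -> dot (ex m) (ex n) = 0.
  move=> mn; rewrite !exE dot_suml big1 // => x _;
    rewrite dot_sumr big1 // => y _.
  by rewrite dotZl dotZr dot_ffvee_neq // !mulr0.
have zx_ortho m n : m != n -> dot (zx m) (zx n) = 0.
  move=> mn; rewrite !zxE dot_suml big1 // => x _;
    rewrite dot_sumr big1 // => y _.
  by rewrite dotZl dotZr dot_ffvee_neq ?mulr0.
(* Different degrees are orthogonal both before and after multiplication by [u], so squared norms
   add and the constant does not grow with the number of degrees. *)
rewrite -(@ler_pXn2r _ 2) ?nnegrE ?mulr_ge0 ?nm_ge0 ?growth_ge0 //.
rewrite exprMn (pythagoras (iota_uniq _ _) zx_ortho).
rewrite (pythagoras (iota_uniq _ _) ex_ortho) mulr_sumr; apply: ler_sum => n _.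
rewrite -exprMn ler_pXn2r ?nnegrE ?mulr_ge0 ?nm_ge0 ?growth_ge0 //.
rewrite zxE exE -(ler_pM2r (w_gt0 n)).
pose c (x : cplx R * seq h) := x.1.
pose v (x : cplx R * seq h) (i : 'I_n) := x.2`_i.
have := creation_degree F w_gt0 [seq x <- r | size x.2 == n] c v u.
rewrite /c /v; set z := nm (\sum_(x <- _) _).
set y := nm (\sum_(x <- _) _).
have p0 : 0 <= nm u * y by rewrite mulr_ge0 ?nm_ge0.
move=> /le_trans; apply; have := ler_wpM2l p0 (w_growth n).
by congr (_ <= _); ring.
Qed.

Lemma creation_exists u : exists b : F -> F, [/\ linear b,
  forall x, nm (b x) <= Cw * nm u * nm x &
    forall s, b (fvee F s) = fvee F (u :: s)].
Proof.
have [|x||b [lb bb bE]] := @bounded_extension _ _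
    (fun x y => exists s, x = fvee F s /\ y = fvee F (u :: s)) (Cw * nm u).
- by rewrite mulr_ge0 ?nm_ge0 ?growth_ge0.
- rewrite lin_ext_dom; apply: approx_span (approx_fvee w_gt0 x) => _ [s _ <-].
  by apply/approx_sub/span_gen; exists (fvee F (u :: s)), s.
- exact: creation_bound.
by exists b; split=> // s; apply: bE; apply: lin_ext_gen; exists s.
Qed.

(** Variant of [creation] with an explicit operator bound in place of continuity. *)
Definition creation_op u (b : F -> F) : Prop :=
  bounded_op b /\ forall s, b (fvee F s) = fvee F (u :: s).

End CreationAnnihilation.

(** * Annihilation operators *)

Section Annihilation.
Variables (R : realType) (h : hilbertType R).
Variable T : forall n, tensor_power h n.
Variables (w : nat -> R) (F : fock T w).
Hypothesis w_gt0 : forall n, 0 < w n.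

(** The value of a_u on v_1 \/ ... \/ v_n: each factor in turn is contracted with [u]. The quotient
    of squared weights comes from the inner product of Fock space, the factor 1/(m+1) from the
    averaging in the symmetric product; degree 0 is annihilated. *)
Definition ann_fvee u n : ('I_n -> h) -> F :=
  match n with
  | 0 => fun=> 0
  | m.+1 => fun v => ((w m.+1 ^+ 2 / w m ^+ 2 / m.+1%:R)%:C)%C *:
      \sum_i dot u (v i) *: ffvee F (fun j => v (lift i j))
  end.

(** The permanent on the left is expanded along the row of [u]; the quotient of the two factorials
    supplies the factor 1/(n+1). *)
Lemma dot_ucons_ffvee u m (v' : 'I_m -> h) n (v : 'I_n -> h) :
  dot (ffvee F (ucons u v')) (ffvee F v) = dot (ffvee F v') (ann_fvee u v).
Proof.
case: n v => [v|n v]; first by rewrite dot0r dot_ffvee_neq.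
rewrite /ann_fvee dotZr dot_sumr; have [mn|mn] := eqVneq m n; last first.
  rewrite dot_ffvee_neq // big1 ?mulr0 // => i _.
  by rewrite dotZr dot_ffvee_neq ?mulr0.
subst m; rewrite dot_ffvee.
rewrite (expand_permanent (fun i j => dot (ucons u v' i) (v j))).
rewrite mulrA !mulr_sumr; apply: eq_bigr => j _.
rewrite dotZr dot_ffvee ucons0.
under eq_bigr do under eq_bigr do rewrite uconsS.
set z := \sum_s _; rewrite factS natrM.
have wn : ((w n)%:C)%C != 0 :> cplx R.
  by rewrite -[0]/((0%:C)%C) (inj_eq (@complexI R)) gt_eqF.
rewrite !(rmorphM, rmorphXn, fmorphV) /= rmorph_nat.
have fn : n`!%:R != 0 :> cplx R by rewrite pnatr_eq0 -lt0n fact_gt0.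
have n1 : 1 + n%:R != 0 :> cplx R by rewrite nat1r pnatr_eq0.
move: ((w n)%:C)%C ((w n.+1)%:C)%C (n`!%:R) wn fn => x y f x0 f0.
by field; apply/and3P.
Qed.

(** Conjugation makes both sides linear in [z]; being bounded, they agree once they agree on
    products. *)
Lemma dot_creation_ext u (b : F -> F) (x y : F) : creation_op u b ->
  (forall m (v : 'I_m -> h),
    dot (ffvee F (ucons u v)) x = dot (ffvee F v) y) ->
  forall z, dot (b z) x = dot z y.
Proof.
move=> [[lb [C C0 bb]] bE] xy z; rewrite dotJ [RHS]dotJ; congr (_ ^*).
apply/eqP; rewrite -subr_eq0; apply/eqP; move: z.
pose f (z : F) : cplx R := dot x (b z) - dot y z.
suff f0 z : f z = 0 by [].
apply: (@linear_approx_eq0 _ _ (range (fvee F)) _ f (nm x * C + nm y)).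
- move=> c z1 z2; rewrite /f lb !dotDr !dotZr -[c *: _]/(c * _); ring.
- move=> z1; rewrite /f mulrDl; apply: (le_trans (nmD _ _)); rewrite nmN.
  apply: lerD; last exact: nm_dot.
  apply: (le_trans (nm_dot _ _)).
  by rewrite -mulrA ler_wpM2l ?nm_ge0.
- move=> _ [s _ <-]; rewrite /f bE (ffvee_ucons F u (erefl (size s))).
  by rewrite dotJ xy -dotJ (ffvee_seq F (erefl (size s))) subrr.
- exact: approx_fvee.
Qed.

Lemma ann_ffvee u (b a : F -> F) n (v : 'I_n -> h) : creation_op u b ->
  adjoint a b -> a (ffvee F v) = ann_fvee u v.
Proof.
move=> cb ab; apply/eqP; rewrite -subr_eq0; apply/eqP.
apply: approx_ortho (approx_fvee w_gt0 _) => _ [s _ <-].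
rewrite dotBr [dot _ (a _)]dotJ ab -dotJ.
by rewrite (dot_creation_ext cb (fun m v' => dot_ucons_ffvee u v' v)) subrr.
Qed.

(** The adjoint relation alone gives linearity, the defect being orthogonal to itself, and the
    bound, from |a x|^2 = <x, b (a x)>. *)
Lemma adjoint_bounded u (b a : F -> F) : creation_op u b -> adjoint a b ->
  bounded_op a.
Proof.
move=> [[lb [C C0 bb]] bE] ab; split.
  move=> c x y; apply/eqP; rewrite -subr_eq0; apply/eqP; apply: dot_eq0.
  by set z := (X in dot _ X); rewrite dotBl dotDl dotZl !ab dotDl dotZl subrr.
exists C => // x; apply: nm_sqr_le; first by rewrite mulr_ge0 ?nm_ge0.
have := dot_nm (a x); rewrite ab => E.
have : nm (dot x (b (a x))) <= C * nm x * nm (a x).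
  apply: (le_trans (nm_dot _ _)); rewrite -mulrA mulrCA.
  by rewrite ler_wpM2l ?nm_ge0.
by rewrite E nmC; apply: le_trans; rewrite ler_norm.
Qed.

(** The formula on products defines a relation that satisfies the adjoint identity on its span. For
    a pair (x, y) in it, |y|^2 = <b y, x>, which bounds y by x and so yields both single-valuedness
    and the extension. *)
Lemma annihilation_exists u (b : F -> F) : creation_op u b ->
  exists2 a, bounded_op a & adjoint a b.
Proof.
move=> cb.
pose G x y := exists n (v : 'I_n -> h), x = ffvee F v /\ y = ann_fvee u v.
have Gb x y : lin_ext G x y -> forall z, dot (b z) x = dot z y.
  elim=> [|c x1 y1 x2 y2 [n [v [-> ->]]] _ ih] z; first by rewrite !dot0r.
  rewrite 2!dotDr ih 2!dotZr.
  by rewrite (dot_creation_ext cb (fun m v' => dot_ucons_ffvee u v' v)).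
have [[_ [C C0 bb]] _] := cb.
have [|x y xy|a [la ba aE]] := @bounded_extension _ _ G C C0.
- move=> x; rewrite lin_ext_dom.
  apply: approx_span (approx_fvee w_gt0 x) => _ [s _ <-].
  apply/approx_sub/span_gen; exists (ann_fvee u (fun i : 'I_(size s) => s`_i)).
  by exists (size s), (fun i : 'I_(size s) => s`_i).
- apply: nm_sqr_le; first by rewrite mulr_ge0 ?nm_ge0.
  have := dot_nm y; rewrite -(Gb _ _ xy) => E.
  have : nm (dot (b y) x) <= C * nm x * nm y.
    apply: (le_trans (nm_dot _ _)); rewrite mulrAC.
    by rewrite ler_wpM2r ?nm_ge0.
  by rewrite E nmC; apply: le_trans; rewrite ler_norm.
exists a; first by split=> //; exists C.
move=> x y; rewrite dotJ [RHS]dotJ; congr (_ ^*); symmetry; move: y.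
have aF n (v : 'I_n -> h) : a (ffvee F v) = ann_fvee u v.
  by apply: aE; apply: lin_ext_gen; exists n, v.
move=> y; apply/eqP; rewrite -subr_eq0; apply/eqP; move: x.
pose f (z : F) : cplx R := dot (b y) z - dot y (a z).
suff f0 z : f z = 0 by [].
apply: (@linear_approx_eq0 _ _ (range (fvee F)) _ f (nm (b y) + nm y * C)).
- move=> c z1 z2; rewrite /f la !dotDr !dotZr -[c *: _]/(c * _); ring.
- move=> z1; rewrite /f mulrDl; apply: (le_trans (nmD _ _)); rewrite nmN.
  apply: lerD; first exact: nm_dot.
  apply: (le_trans (nm_dot _ _)).
  by rewrite -mulrA ler_wpM2l ?nm_ge0.
- move=> _ [s _ <-]; rewrite /f -(ffvee_seq F (erefl (size s))) aF.
  by rewrite (dot_creation_ext cb (fun m v' => dot_ucons_ffvee u v' _)) subrr.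
- exact: approx_fvee.
Qed.

End Annihilation.

(** * Commutators of D with the generators *)

Section Derivation.
Variables (R : realType) (h : hilbertType R).
Variable T : forall n, tensor_power h n.
Variables (w : nat -> R) (F : fock T w).
Hypothesis w_gt0 : forall n, 0 < w n.
Variables (dom : set h) (L : h -> h).
Hypothesis L_skew : forall u v, dom u -> dom v -> dot (L u) v = - dot u (L v).

Local Notation D := (Dgraph F dom L).

Definition upd (V : Type) n (v : 'I_n -> V) i z : 'I_n -> V :=
  fun j => if j == i then z else v j.

Definition dfvee n (v : 'I_n -> h) : F :=
  \sum_i ffvee F (upd v i (L (v i))).

Lemma dfvee_seq (s : seq h) n : size s = n ->
  dfvee (fun i : 'I_n => s`_i) =
  \sum_(i < size s) fvee F (set_nth 0 s i (L s`_i)).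
Proof.
move=> <-; apply: eq_bigr => i _.
have ss : size (set_nth 0 s i (L s`_i)) = size s.
  by rewrite size_set_nth; apply/maxn_idPr; exact: ltn_ord.
rewrite -(ffvee_seq F ss); congr (ffvee F); apply/funext => j.
by rewrite nth_set_nth.
Qed.

Lemma lin_ext_sum (E : hilbertType R) (G : E -> E -> Prop) I (r : seq I)
    (c : I -> cplx R) (x y : I -> E) :
  (forall i, lin_ext G (x i) (y i)) ->
  lin_ext G (\sum_(i <- r) c i *: x i) (\sum_(i <- r) c i *: y i).
Proof.
move=> Gxy; elim: r => [|i r ih]; first by rewrite !big_nil; exact: lin_ext0.
by rewrite !big_cons; exact: lin_ext_lin.
Qed.

Lemma Dgraph_ffvee n (v : 'I_n -> h) :
  (forall i, dom (v i)) -> D (ffvee F v) (dfvee v).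
Proof.
move=> dv; have [s [ss sv vs]] := ffvee_of_seq F v.
apply: lin_ext_gen; exists s; split=> //.
  move=> u us; have : (index u s < n)%N by rewrite -ss index_mem.
  by move=> si; rewrite -(nth_index 0 us) (sv (Ordinal si)).
by rewrite -(dfvee_seq ss); congr dfvee; apply/funext => i; rewrite sv.
Qed.

Lemma Dgraph_ind (P : F -> F -> Prop) :
  P 0 0 ->
  (forall (c : cplx R) n (v : 'I_n -> h) x y, (forall i, dom (v i)) -> P x y ->
    P (c *: ffvee F v + x) (c *: dfvee v + y)) ->
  forall x y, D x y -> P x y.
Proof.
move=> P0 PD x y; elim=> // c _ _ x' y' [s [ds -> ->]] _ ih.
rewrite -(ffvee_seq F (erefl (size s))) -(dfvee_seq (erefl (size s))).
by apply: PD => // i; apply: ds; exact: mem_nth.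
Qed.

(** Leibniz rule: the term in which [L] hits the new factor [u] is [b' x], all the others make up
    [b y]. *)
Lemma Dgraph_creation u (b b' : F -> F) : dom u ->
  creation_op u b -> creation_op (L u) b' ->
  forall x y, D x y -> D (b x) (b' x + b y).
Proof.
move=> du [[lb _] bE] [[lb' _] bE'].
have bf (z : h) (c : F -> F) n (v : 'I_n -> h) :
    (forall s, c (fvee F s) = fvee F (z :: s)) ->
    c (ffvee F v) = ffvee F (ucons z v).
  move=> cE; have [s [ss sv ->]] := ffvee_of_seq F v.
  rewrite cE (ffvee_ucons F z ss); congr (ffvee F (ucons z _)).
  exact/funext.
have [b0 _ _ _] := linear_spec lb; have [b0' _ _ _] := linear_spec lb'.
apply: Dgraph_ind => [|c n v x y dv ih].
  by rewrite b0 b0' addr0; exact: lin_ext0.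
have -> : b' (c *: ffvee F v + x) + b (c *: dfvee v + y) =
    c *: (b' (ffvee F v) + b (dfvee v)) + (b' x + b y).
  by rewrite lb lb' scalerDr addrACA.
rewrite lb; apply: lin_ext_lin ih; rewrite (bf _ _ _ _ bE) (bf _ _ _ _ bE').
have -> : ffvee F (ucons (L u) v) + b (dfvee v) = dfvee (ucons u v).
  rewrite /dfvee (linear_sumP lb) big_ord_recl ucons0; congr (_ + _).
    congr (ffvee F); apply/funext => i.
    by case: (unliftP ord0 i) => [j|] ->; rewrite /upd ?uconsS ?ucons0.
  apply: eq_bigr => i _; rewrite (bf _ _ _ _ bE) uconsS; congr (ffvee F).
  apply/funext => k; case: (unliftP ord0 k) => [j|] ->.
    by rewrite uconsS /upd (inj_eq (@lift_inj _ _)) uconsS.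
  by rewrite ucons0 /upd ucons0.
by apply: Dgraph_ffvee => i; case: (unliftP ord0 i) => [j|] ->;
  rewrite ?uconsS ?ucons0.
Qed.

(** In a (D v), the terms where [L] hits the contracted factor carry <u, L v_i> = - <L u, v_i> and
    cancel the value of [a']; what remains is D (a v). *)
Lemma Dgraph_annihilation u (b a b' a' : F -> F) : dom u ->
  creation_op u b -> adjoint a b -> creation_op (L u) b' -> adjoint a' b' ->
  forall x y, D x y -> D (a x) (a' x + a y).
Proof.
move=> du cb ab cb' ab'.
have [la _] := adjoint_bounded cb ab; have [la' _] := adjoint_bounded cb' ab'.
have [a0 _ _ _] := linear_spec la; have [a0' _ _ _] := linear_spec la'.
apply: Dgraph_ind => [|c n v x y dv ih].
  by rewrite a0 a0' addr0; exact: lin_ext0.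
have -> : a' (c *: ffvee F v + x) + a (c *: dfvee v + y) =
    c *: (a' (ffvee F v) + a (dfvee v)) + (a' x + a y).
  by rewrite la la' scalerDr addrACA.
rewrite la; apply: lin_ext_lin ih.
rewrite (ann_ffvee w_gt0 v cb ab) (ann_ffvee w_gt0 v cb' ab').
case: n v dv => [|n] v dv.
  by rewrite /dfvee /= big_ord0 a0 addr0; exact: lin_ext0.
have -> : ann_fvee F (L u) v + a (dfvee v) =
    ((w n.+1 ^+ 2 / w n ^+ 2 / n.+1%:R)%:C)%C *:
    \sum_i dot u (v i) *: dfvee (fun j => v (lift i j)).
  rewrite /dfvee (linear_sumP la).
  under eq_bigr do rewrite (ann_ffvee w_gt0 _ cb ab).
  rewrite /= -scaler_sumr -scalerDr; congr (_ *: _).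
  (* After the exchange the outer index is the contracted factor and the inner one the factor hit by
     [L]; the diagonal term is split off for the cancellation. *)
  rewrite exchange_big -big_split; apply: eq_bigr => i _ /=.
  rewrite (bigD1_ord i) //= addrA {1}/upd eqxx.
  have -> : (fun j => upd v i (L (v i)) (lift i j)) = fun j => v (lift i j).
    by apply/funext => j; rewrite /upd eq_sym (negPf (neq_lift _ _)).
  rewrite -scalerDl L_skew // addNr scale0r add0r scaler_sumr.
  apply: eq_bigr => j _; rewrite {1}/upd (negPf (neq_lift _ _)).
  congr (_ *: ffvee F _); apply/funext => k.
  by rewrite /upd (inj_eq (@lift_inj _ _)).
by apply: lin_extZ; apply: lin_ext_sum => i; exact: Dgraph_ffvee.
Qed.

End Derivation.

(** * The operator L on the first amplification *)

Section Amplification.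
Variables (R : realType) (d : nat) (X : topologicalType).
Variables (M : manifold R d X) (V : vector_field M).
Variables (H : hilbertType R) (k : X -> H) (Hinf : set H).
Hypothesis h1 : assumption1 V k Hinf.
Variables (l2 : ell2 R) (hh : tensor_product l2 H).

Lemma Vop_graph f : Hinf f -> Vgraph V k f (Vop V k f).
Proof. by move=> /(a1_dom h1)[+ _]; exact: xgetPex. Qed.

Lemma Vadj_dot f g : Hinf f -> Hinf g ->
  dot f (Vop V k g) = dot (Vadj V k f) g.
Proof.
move=> /(a1_dom h1)[_ ff] /Vop_graph gg.
have : op_adj (Vgraph V k) f (Vadj V k f) by exact: xgetPex ff.
exact.
Qed.

Lemma conj_half : ((2%:R : cplx R)^-1)^* = 2%:R^-1.
Proof. by rewrite conj_Creal // rpredV realn. Qed.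

Lemma Sop_sym f g : Hinf f -> Hinf g ->
  dot f (Sop V k g) = dot (Sop V k f) g.
Proof.
move=> ff gg; rewrite /Sop dotZl dotZr conj_half !(dotDl, dotDr).
rewrite Vadj_dot // addrC; congr (_ * (_ + _)).
by rewrite dotJ -Vadj_dot // -dotJ.
Qed.

Lemma Aop_skew f g : Hinf f -> Hinf g ->
  dot f (Aop V k g) = - dot (Aop V k f) g.
Proof.
move=> ff gg; rewrite /Aop dotZl dotZr conj_half !(dotBl, dotBr) -mulrN opprB.
rewrite Vadj_dot //; congr (_ * (_ - _)).
by rewrite dotJ -Vadj_dot // -dotJ.
Qed.

Lemma SopAop f : Sop V k f + Aop V k f = Vop V k f.
Proof.
rewrite /Sop /Aop -scalerDr addrACA subrr addr0 -mulr2n.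
by rewrite -[Vop V k f *+ 2]scaler_nat scalerA mulVf ?scale1r // pnatr_eq0.
Qed.

Lemma Hinf_SA f : Hinf f -> Hinf (Sop V k f) /\ Hinf (Aop V k f).
Proof.
have [H0 Hlin] := a1_subspace h1.
move=> /(a1_inv h1)[vf af].
have HZ c g : Hinf g -> Hinf (c *: g).
  by move=> gg; rewrite -[_ *: _]addr0; exact: Hlin.
split; apply: HZ; first by rewrite -[Vop V k f]scale1r; exact: Hlin.
by rewrite addrC -scaleN1r; exact: Hlin.
Qed.

Local Notation G := (fun u v => exists i f,
  [/\ Hinf f, u = tp hh (ell2_e l2 i) f & v = Lsimple V k hh i f]).

Lemma Lsimple_h0 i f : Hinf f -> h0 hh Hinf (Lsimple V k hh i f).
Proof.
move=> /Hinf_SA[Sf Af]; have g j g : Hinf g -> h0 hh Hinf (tp hh (ell2_e l2 j)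
  g).
  by move=> gg; apply: span_gen; exists j, g.
have D u v : h0 hh Hinf u -> h0 hh Hinf v -> h0 hh Hinf (u + v).
  by move=> uu vv; rewrite -[u]scale1r; exact: span_lin.
have N u : h0 hh Hinf u -> h0 hh Hinf (- u).
  by move=> uu; rewrite -[- u]addr0 -scaleN1r; apply: span_lin => //;
    exact: span0.
apply: (D); last by apply: (N); exact: g.
by apply: (D); last exact: g; case: i => [|i]; [exact: span0|exact: g].
Qed.

(** The matrix of [L] is tridiagonal: skew entries A on the diagonal, and the symmetric S with
    opposite signs above and below it. *)
Lemma Lsimple_skew i f j g : Hinf f -> Hinf g ->
  dot (tp hh (ell2_e l2 i) f) (Lsimple V k hh j g) =
  - dot (Lsimple V k hh i f) (tp hh (ell2_e l2 j) g).
Proof.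
move=> ff gg.
have dR i' j' f' g' : dot (tp hh (ell2_e l2 i') f') (tp hh (ell2_e l2 j') g') =
    (i' == j')%:R * dot f' g' by rewrite tp_dot ell2_dot.
have up i' j' f' g' : dot (tp hh (ell2_e l2 i') f')
    (if j' is j''.+1 then tp hh (ell2_e l2 j'') g' else 0) =
    (i'.+1 == j')%:R * dot f' g'.
  by case: j' => [|j']; [rewrite dot0r mul0r|rewrite dR].
have upl i' j' f' g' : dot (if j' is j''.+1 then tp hh (ell2_e l2 j'') g' else
  0)
    (tp hh (ell2_e l2 i') f') = (i'.+1 == j')%:R * dot g' f'.
  case: j' => [|j']; first by rewrite dot0l mul0r.
  by rewrite dR [j' == i']eq_sym.
rewrite /Lsimple !(dotBr, dotDr, dotBl, dotDl) up upl !dR.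
rewrite !Sop_sym // !Aop_skew // (eq_sym i.+1 j) (eq_sym j.+1 i).
by rewrite (eq_sym j i.+1); ring.
Qed.

(** Stated for the relation, because single-valuedness of [L] will be deduced from it. *)
Lemma L_skew_rel u v u' v' : lin_ext G u v -> lin_ext G u' v' ->
  dot u v' = - dot v u'.
Proof.
move=> uv uv'; elim: uv => [|a x y x1 y1 [i [f [ff -> ->]]] _ ih].
  by rewrite !dot0l oppr0.
rewrite !dotDl !dotZl ih opprD -mulrN; congr (_ * _ + _).
elim: uv' {ih} => [|b z t z1 t1 [j [g [gg -> ->]]] _ ih].
  by rewrite !dot0r oppr0.
by rewrite !dotDr !dotZr ih Lsimple_skew // mulrN -opprD.
Qed.

Lemma h0_dom : h0 hh Hinf = op_dom (lin_ext G).
Proof.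
rewrite lin_ext_dom /h0; congr (Defs.span _); apply/seteqP; split=> u.
  by move=> [i [f [ff ->]]]; exists (Lsimple V k hh i f), i, f.
by move=> [_ [i [f [ff -> _]]]]; exists i, f.
Qed.

(* No density is needed: L maps into its own domain, hence a value of L at 0 is
   orthogonal to itself. *)
Lemma L_functional u v v' : lin_ext G u v -> lin_ext G u v' -> v = v'.
Proof.
have im0 a b : lin_ext G a b -> h0 hh Hinf b.
  elim=> [|c x y x' y' [i [f [ff _ ->]]] _ ih]; first exact: span0.
  by apply: span_lin => //; exact: Lsimple_h0.
move=> uv uv'; have /= := lin_ext_lin (-1) uv uv'; rewrite !scaleN1r addNr => z.
have := im0 _ _ z; rewrite h0_dom => -[t zt].
have := L_skew_rel z zt; rewrite dot0l => /esym/eqP.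
by rewrite oppr_eq0 => /eqP/dot_eq0/eqP; rewrite addrC subr_eq0 => /eqP.
Qed.

Lemma Lop_graph u : h0 hh Hinf u -> lin_ext G u (Lop V k Hinf hh u).
Proof. by rewrite h0_dom; exact: xgetPex. Qed.

Lemma Lop_skew u v : h0 hh Hinf u -> h0 hh Hinf v ->
  dot (Lop V k Hinf hh u) v = - dot u (Lop V k Hinf hh v).
Proof.
move=> /Lop_graph uu /Lop_graph vv.
by rewrite (L_skew_rel uu vv) opprK.
Qed.

Lemma En_graph n f : Hinf f -> lin_ext G (En hh n f)
  (\sum_(i < n) ((fib i.+1)%:R : cplx R) *: Lsimple V k hh i f).
Proof.
move=> ff; apply: lin_ext_sum => i; apply: lin_ext_gen.
by exists (i : nat), f.
Qed.

Lemma En_h0 n f : Hinf f -> h0 hh Hinf (En hh n f).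
Proof. by move=> /(En_graph n) g; rewrite h0_dom;
  exists (\sum_(i < n) ((fib i.+1)%:R : cplx R) *: Lsimple V k hh i f). Qed.

Lemma dot_En n f g : (0 < n)%N ->
  dot (tp hh (ell2_e l2 0) g) (En hh n f) = dot g f.
Proof.
case: n => // n _; rewrite /En dot_sumr big_ord_recl big1 ?addr0.
  by rewrite dotZr tp_dot ell2_dot eqxx !mul1r.
by move=> i _; rewrite dotZr tp_dot ell2_dot mul0r mulr0.
Qed.

(** The component along e_1 receives A f from the first summand of E_n f and S f from the second.
    With n = 1 the second would be missing and only A f would be left. *)
Lemma dot_LEn n f g : (1 < n)%N -> Hinf f ->
  dot (tp hh (ell2_e l2 0) g) (Lop V k Hinf hh (En hh n f)) =
  dot g (Vop V k f).
Proof.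
move=> n1 ff.
rewrite (L_functional (Lop_graph (En_h0 n ff)) (En_graph n ff)) dot_sumr.
case: n n1 => [|[|n]] // _; rewrite big_ord_recl big_ord_recl big1 ?addr0.
  rewrite !dotZr /= !mul1r /Lsimple !(dotBr, dotDr) !tp_dot !ell2_dot dot0r.
  by rewrite /= !mul0r !mul1r subr0 add0r !addr0 subr0 addrC -dotDr SopAop.
move=> i _; rewrite dotZr /Lsimple !(dotBr, dotDr) /= !tp_dot !ell2_dot.
by rewrite /= !mul0r !addr0 subr0 mulr0.
Qed.

End Amplification.

(** * Limits and approximate eigenvectors *)

Section Limits.
Variables (R : realType) (E F : hilbertType R).

Lemma bounded_cvg (a : E -> F) (u : nat -> E) (l : E) : bounded_op a ->
  u @ \oo --> l -> (fun n => a (u n)) @ \oo --> a l.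
Proof.
move=> [la [C C0 ba]] /cvg_nmP ul; apply/cvg_nmP => e e0.
have [_ _ aB _] := linear_spec la.
have C1 : 0 < C + 1 by lra.
apply: filterS (ul (e / (C + 1)) (divr_gt0 e0 C1)) => n; rewrite -aB.
rewrite ltr_pdivlMr // => h; apply: (le_lt_trans (ba _)).
by apply: le_lt_trans h; rewrite mulrC ler_wpM2l ?nm_ge0 //; lra.
Qed.

Lemma nm_lim_le (u : nat -> E) (l : E) (c : R) :
  u @ \oo --> l -> (forall n, nm (u n) <= c) -> nm l <= c.
Proof.
move=> /cvg_nmP ul uc; apply/ler_addgt0Pl => e e0.
have [N _ hN] := ul _ e0; have := hN N (leqnn N); have := uc N.
by have := nmD (l - u N) (u N); rewrite subrK; lra.
Qed.

End Limits.

Section ApproximateEigenvectors.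
Variables (R : realType) (h : hilbertType R).
Variable T : forall n, tensor_power h n.
Variables (w : nat -> R) (F : fock T w).
Hypothesis w_gt0 : forall n, 0 < w n.

(** For a unit vector, [q n] is the squared norm of the degree-n term of K^(m), and [rho n] is the
    quotient of consecutive terms [q n] and [q n.+1]. *)
Let q n : R := (w n ^+ 2)^-1.
Let rho n : R := w n.+1 ^+ 2 / w n ^+ 2.
Hypothesis q_summable : cvgn (series q).
Hypothesis rho_cvg : rho @ \oo --> (1 : R).

Let q_gt0 n : 0 < q n.
Proof. by rewrite invr_gt0 exprn_gt0. Qed.

Let q_rho n : q n = rho n * q n.+1.
Proof.
by rewrite /q /rho; field; rewrite !gt_eqF ?exprn_gt0.
Qed.

(** The remainder of the series from [m] on, which is the squared norm of K^(m). *)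
Definition tail m : R := limn (series (fun n => (w n ^+ 2)^-1)) -
  series (fun n => (w n ^+ 2)^-1) m.

Let series_mono : {homo series q : m n / (m <= n)%N >-> m <= n}.
Proof. by apply: nondecreasing_series => n _ _; rewrite ltW. Qed.

Let tailS m : tail m = q m + tail m.+1.
Proof. by rewrite /tail -/q seriesSr; ring. Qed.

Let tail_ge m N : \sum_(m <= j < N) q j <= tail m.
Proof.
have [mN|/ltnW Nm] := leqP m N.
  rewrite /tail -sub_series_geq // lerB //.
  exact: nondecreasing_cvgn_le.
rewrite big_geq // subr_ge0; exact: nondecreasing_cvgn_le.
Qed.

Let tail_gt0 m : 0 < tail m.
Proof.
by rewrite tailS; have := tail_ge m.+1 0; rewrite big_geq // => t0;
  rewrite ltr_wpDr.
Qed.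

(* Eventually q(j+1) >= (1 - d) q(j); summing over j >= m,
   tail(m+1) >= (1 - d) (q(m) + tail(m+1)). *)
Let q_tail (e : R) : 0 < e -> \forall m \near \oo, q m <= e * tail m.+1.
Proof.
(* [d] solves d = (1 - d) e, so (1 - d) q(m) <= d tail(m+1) is exactly the claim. *)
move=> e0; pose d := e / (1 + e).
have d01 : 0 < d < 1 by rewrite /d divr_gt0 ?ltr_pdivrMr //=; lra.
have dE : d = (1 - d) * e by rewrite /d; field; lra.
have [N _ hN] : \forall j \near \oo, (1 - d) * q j <= q j.+1.
  have : 1 < (1 - d)^-1 by rewrite invf_gt1; lra.
  move=> /(cvgr_lt 1 rho_cvg); apply: filterS => j rj.
  rewrite q_rho mulrA -[leRHS]mul1r ler_pM2r //.
  by rewrite -ler_pdivlMl ?mulr1 ?ltW; lra.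
near=> m.
have Nm : (N <= m)%N by near: m; exact: nbhs_infty_ge.
suff : (1 - d) * tail m <= tail m.+1.
  rewrite tailS mulrDr => hd.
  have : (1 - d) * q m <= (1 - d) * (e * tail m.+1) by rewrite mulrA -dE; lra.
  by rewrite ler_pM2l //; lra.
have c1 : (fun n => (1 - d) * (series q n - series q m)) @ \oo --> (1 - d) *
  tail m.
  by apply: cvgMl_tmp; apply: cvgB => //; exact: cvg_cst.
have c2 : (fun n => series q n.+1 - series q m.+1) @ \oo --> tail m.+1.
  by apply: cvgB; [rewrite cvg_shiftS|exact: cvg_cst].
rewrite -(cvg_lim _ c1) // -(cvg_lim _ c2) //; apply: ler_lim.
- by apply/cvg_ex; exists ((1 - d) * tail m).
- by apply/cvg_ex; exists (tail m.+1).
near=> n; have mn : (m <= n)%N by near: n; exact: nbhs_infty_ge.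
rewrite !sub_series_geq // big_add1 /= mulr_sumr;
  apply: ler_sum_nat => j /andP[mj _].
exact: hN (leq_trans Nm mj).
Unshelve. all: by end_near. Qed.

Definition pterm (v : h) n : F := (((w n ^+ 2)^-1)%:C)%C *: fvee F (nseq n v).

(* For v = e_1 (x) k_x this is K_x^(m), i.e. [Kvec k F x m]. *)
Definition cohvec (v : h) m : F :=
  lim ((\sum_(m <= j < N) pterm v j) @[N --> \oo]).

Definition near_eigen (v : h) (a : F -> F) (lam : cplx R) : Prop :=
  forall e : R, 0 < e -> \forall m \near \oo,
    nm (a (cohvec v m) - lam *: cohvec v m) <= e * nm (cohvec v m).

Lemma fvee_nseq n (v : h) : fvee F (nseq n v) = ffvee F (fun _ : 'I_n => v).
Proof.
rewrite -(ffvee_seq F (size_nseq n v)); congr (ffvee F); apply/funext => i.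
by rewrite nth_nseq ltn_ord.
Qed.

Lemma dot_fvee_const n (v : h) (x : 'I_n -> h) :
  dot (ffvee F (fun _ : 'I_n => v)) (ffvee F x) =
  ((w n ^+ 2)%:C)%C * \prod_i dot v (x i).
Proof.
rewrite dot_ffvee; congr (_ * _).
rewrite (eq_bigr (fun _ : 'S_n => \prod_i dot v (x i))) => [|s _]; last first.
  by rewrite [RHS](reindex_inj (@perm_inj _ s)).
rewrite sumr_const card_Sn -[(\prod_i dot v (x i)) *+ _]mulr_natl mulrA.
by rewrite mulVf ?mul1r // pnatr_eq0 -lt0n fact_gt0.
Qed.

Section UnitVector.
Variable v : h.
Hypothesis v1 : nm v = 1.

Let vv : dot v v = 1.
Proof. by rewrite dot_nm v1 expr1n. Qed.

Let dot_pow m n : dot (fvee F (nseq m v)) (fvee F (nseq n v)) =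
  (m == n)%:R * ((w n ^+ 2)%:C)%C.
Proof.
rewrite !fvee_nseq; have [->|mn] := eqVneq m n;
  last by rewrite dot_ffvee_neq ?mul0r.
by rewrite dot_fvee_const big1 ?mulr1 ?mul1r.
Qed.

Let wqC n : (((w n ^+ 2)^-1)%:C)%C * ((w n ^+ 2)%:C)%C = 1 :> cplx R.
Proof. by rewrite -rmorphM /= mulVf ?rmorph1 // expf_neq0 // gt_eqF. Qed.

Let wC_neq0 n : ((w n)%:C)%C != 0 :> cplx R.
Proof. by rewrite -[0]/((0%:C)%C) (inj_eq (@complexI R)) gt_eqF. Qed.

Let conjR (r : R) : ((r%:C)%C : cplx R)^* = (r%:C)%C.
Proof. by rewrite conj_Creal //; exact: (etrans (complex_real r 0) (eqxx _)).
  Qed.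

Let conjM (a b : cplx R) : (a * b)^* = a^* * b^*.
Proof. exact: rmorphM. Qed.

Let pterm_ortho m n : m != n -> dot (pterm v m) (pterm v n) = 0.
Proof. by move=> mn; rewrite /pterm dotZl dotZr dot_pow (negPf mn) mul0r
  !mulr0. Qed.

Let nm_pterm n : nm (pterm v n) ^+ 2 = q n.
Proof.
apply: (@complexI R); rewrite -dot_nm /pterm dotZl dotZr dot_pow eqxx mul1r.
by rewrite wqC mulr1 conjR.
Qed.

(** Pythagoras on partial sums. Since the norm of K^(m) is the square root of [tail m], a relative
    error [c] in each term gives a relative error [c] in the sum. *)
Lemma ortho_series_bound (x : nat -> F) (c : R) m (s : F) : 0 <= c ->
  (forall i j, i != j -> dot (x i) (x j) = 0) ->
  (forall j, (m <= j)%N -> nm (x j) ^+ 2 <= c ^+ 2 * (w j ^+ 2)^-1) ->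
  (fun N => \sum_(m <= j < N) x j) @ \oo --> s ->
  nm s <= c * Num.sqrt (tail m).
Proof.
move=> c0 ox xq xs; apply: nm_lim_le xs _ => N.
rewrite -(@ler_pXn2r _ 2) ?nnegrE ?nm_ge0 ?mulr_ge0 ?sqrtr_ge0 //.
rewrite exprMn sqr_sqrtr ?(ltW (tail_gt0 _)) // (pythagoras (iota_uniq _ _) ox).

apply: (@le_trans _ _ (c ^+ 2 * \sum_(m <= j < N) q j)); last first.
  by rewrite ler_wpM2l ?tail_ge ?exprn_ge0.
by rewrite mulr_sumr; apply: ler_sum_nat => j /andP[mj _]; exact: xq.
Qed.

(** [cohvec] is a [lim], so it has a meaning only once the partial sums are known to be Cauchy;
    orthogonality reduces this to the summability of [q]. *)
Lemma cohvec_cvg m : (fun N => \sum_(m <= j < N) pterm v j) @ \oo --> cohvec v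
  m.
Proof.
apply: nm_cauchy_cvg => e e0.
have e20 : 0 < e ^+ 2 by rewrite exprn_gt0.
have /cvgrPdist_lt/(_ _ e20)[N _ hN] : series q @ \oo --> limn (series q) by [].
exists (maxn N m).
suff W a b : (maxn N m <= a)%N -> (a <= b)%N ->
    nm (\sum_(m <= j < a) pterm v j - \sum_(m <= j < b) pterm v j) < e.
  move=> a b aN bN; have [ab|/ltnW ba] := leqP a b; first exact: W.
  by rewrite nmB; exact: W.
rewrite geq_max => /andP[Na ma] ab; rewrite nmB.
rewrite (big_cat_nat ma ab) /= addrC addrK.
rewrite -(@ltr_pXn2r _ 2) ?nnegrE ?nm_ge0 ?(ltW e0) //.
rewrite (pythagoras (iota_uniq _ _) pterm_ortho).
under eq_bigr do rewrite nm_pterm.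
apply: (le_lt_trans (tail_ge a b)); rewrite /tail.
by have := hN a Na; apply: le_lt_trans; rewrite ler_norm.
Qed.

Lemma nm_cohvec m : nm (cohvec v m) = Num.sqrt (tail m).
Proof.
apply/eqP; rewrite eq_le; apply/andP; split.
  rewrite -[leRHS]mul1r; apply: (@ortho_series_bound (pterm v) 1 m _ ler01
    pterm_ortho _ (@cohvec_cvg m)).
  by move=> j _; rewrite nm_pterm expr1n mul1r.
rewrite -(@ler_pXn2r _ 2) ?nnegrE ?nm_ge0 ?sqrtr_ge0 // sqr_sqrtr ?(ltW
  (tail_gt0 _)) //.
have c1 : (fun n => series q n - series q m) @ \oo --> tail m.
  by apply: cvgB => //; exact: cvg_cst.
rewrite -(cvg_lim _ c1) //; apply: limr_le.
  by apply/cvg_ex; exists (tail m).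
near=> N; have mN : (m <= N)%N by near: N; exact: nbhs_infty_ge.
rewrite sub_series_geq //; under eq_bigr do rewrite -nm_pterm.
rewrite -(pythagoras (iota_uniq _ _) pterm_ortho).
rewrite ler_pXn2r ?nnegrE ?nm_ge0 //.
apply/ler_addgt0Pl => e e0.
have [N1 _ hN1] := (cvg_nmP _ _).1 (@cohvec_cvg m) e e0.
pose n := maxn N1 N; have Nn : (N <= n)%N by exact: leq_maxr.
have : nm (\sum_(m <= j < N) pterm v j) <= nm (\sum_(m <= j < n) pterm v j).
  rewrite -(@ler_pXn2r _ 2) ?nnegrE ?nm_ge0 //.
  rewrite !(pythagoras (iota_uniq _ _) pterm_ortho) (big_cat_nat mN Nn) /=.
  by rewrite lerDl sumr_ge0 // => j _; rewrite exprn_ge0 ?nm_ge0.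
have := hN1 n (leq_maxl _ _); rewrite nmB.
set P := \sum_(m <= j < n) _; have := nmD (P - cohvec v m) (cohvec v m).
by rewrite subrK; lra.
Unshelve. all: by end_near. Qed.

Let cohvecS m : cohvec v m = pterm v m + cohvec v m.+1.
Proof.
apply: (cvg_unique _ (@cohvec_cvg m)); first exact: norm_hausdorff.
have c1 : (fun n => pterm v m + \sum_(m.+1 <= j < n) pterm v j) @ \oo -->
    pterm v m + cohvec v m.+1.
  by apply: cvgD; [exact: cvg_cst|exact: cohvec_cvg].
apply: (cvg_trans _ c1); apply: near_eq_cvg; near=> n.
have mn : (m < n)%N by near: n; exact: nbhs_infty_gt.
by rewrite /= [RHS]big_ltn.
Unshelve. all: by end_near. Qed.

(** The lowest term is negligible against the rest, which makes a shift between K^(m) and K^(m+1)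
    harmless. *)
Let pterm_small (e : R) : 0 < e -> \forall m \near \oo,
  nm (pterm v m) <= e * nm (cohvec v m.+1).
Proof.
move=> e0; have e20 : 0 < e ^+ 2 by rewrite exprn_gt0.
apply: filterS (q_tail e20) => m qm.
rewrite -(@ler_pXn2r _ 2) ?nnegrE ?nm_ge0 ?mulr_ge0 ?nm_ge0 ?(ltW e0) //.
by rewrite nm_pterm exprMn nm_cohvec sqr_sqrtr // ltW.
Qed.

Lemma cohvec_gt0 m : 0 < nm (cohvec v m).
Proof. by rewrite nm_cohvec sqrtr_gt0. Qed.

Let cohvec_decr m : nm (cohvec v m.+1) <= nm (cohvec v m).
Proof. by rewrite !nm_cohvec ler_wsqrtr // (tailS m) lerDr ltW. Qed.

(** The weights in K^(m) cancel the quotient in [ann_fvee], so that a K^(m+1) = <u, v> K^(m) holds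
    exactly; the error is the single lowest term. *)
Lemma near_eigen_annihilation u (a b : F -> F) :
  creation_op u b -> adjoint a b -> near_eigen v a (dot u v).
Proof.
move=> cb ab; have ba := adjoint_bounded cb ab; have [la _] := ba.
have [_ _ _ aZ] := linear_spec la.
have aP n : a (pterm v n.+1) = dot u v *: pterm v n.
  rewrite /pterm aZ fvee_nseq (ann_ffvee w_gt0 _ cb ab) /ann_fvee.
  rewrite sumr_const card_ord -fvee_nseq -[(_ *: _) *+ n.+1]scaler_nat !scalerA.
  congr (_ *: _); rewrite !(rmorphM, fmorphV, rmorphXn) /= rmorph_nat.
  move: ((w n)%:C)%C ((w n.+1)%:C)%C (wC_neq0 n) (wC_neq0 n.+1) => x y x0 y0.
  have n1 : 1 + n%:R != 0 :> cplx R by rewrite nat1r pnatr_eq0.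
  by field; apply/and3P.
have aK m : a (cohvec v m.+1) = dot u v *: cohvec v m.
  have c1 := bounded_cvg ba (@cohvec_cvg m.+1).
  have c2 : (fun n => a (\sum_(m.+1 <= j < n.+1) pterm v j)) @ \oo -->
      a (cohvec v m.+1) by rewrite (cvg_shiftS (fun n => a _)).
  apply: (cvg_unique _ c2); first exact: norm_hausdorff.
  have -> : (fun n => a (\sum_(m.+1 <= j < n.+1) pterm v j)) =
      fun n => dot u v *: \sum_(m <= j < n) pterm v j.
    apply/funext => n; rewrite big_add1 (linear_sumP la) scaler_sumr.
    by apply: eq_bigr => j _; rewrite aP.
  by apply: cvgZl_tmp; exact: cohvec_cvg.
move=> e e0; have d1 : 0 < nm (dot u v) + 1 by have := nm_ge0 (dot u v); lra.
have [N _ hN] := pterm_small (divr_gt0 e0 d1).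
exists N.+1 => // -[//|m] /= Nm; rewrite aK cohvecS scalerDr addrK nmZ.
have := hN m Nm; rewrite mulrAC ler_pdivlMr // => h1.
apply: le_trans h1; rewrite mulrC ler_wpM2l ?nm_ge0 //; lra.
Qed.

(** Each term is compared with the one a degree higher. The defects lie in different degrees, hence
    are orthogonal. The first summand of [eps] is due to the part of [u] orthogonal to [v], the
    second to the change of weight between degrees; both tend to 0. *)
Lemma near_eigen_creation u (b : F -> F) :
  creation_op u b -> near_eigen v b (dot v u).
Proof.
move=> [bb bE]; have [lb _] := bb; have [_ _ bB bZ] := linear_spec lb.
set c := dot v u; pose C := nm c ^+ 2; pose U := nm u ^+ 2.
have cJ : dot u v = c^* by rewrite dotJ.
have cc : c^* * c = (C%:C)%C by rewrite /C rmorphXn /= -nmE normCKC.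
pose r j := b (pterm v j) - c *: pterm v j.+1.
(* [C] = |<v,u>|^2 is the part of [U] = |u|^2 along v; [nr] is the exact norm
   of the defect [r j]. *)
pose eps j := rho j * (U - C) * j.+1%:R^-1 + C * (rho j - 1) ^+ 2 * (rho j)^-1.
have bf n : b (fvee F (nseq n v)) = ffvee F (ucons u (fun _ : 'I_n => v)).
  rewrite bE (ffvee_ucons F u (size_nseq n v)); congr (ffvee F (ucons u _)).
  by apply/funext => i; rewrite nth_nseq ltn_ord.
(* One factor [u] is moved across the inner product as an annihilation: contracting [u] gives U,
   contracting any of the n copies of [v] gives C. *)
have nbf n : dot (b (fvee F (nseq n v))) (b (fvee F (nseq n v))) =
    ((w n.+1 ^+ 2 * (U + n%:R * C) / n.+1%:R)%:C)%C.
  rewrite bf dot_ucons_ffvee // /ann_fvee dotZr dot_sumr big_ord_recl ucons0.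
  rewrite dotZr dot_fvee_const big1 => [|i _]; last by rewrite uconsS vv.
  rewrite (eq_bigr (fun=> c^* * (((w n ^+ 2)%:C)%C * c))) => [|i _]; last first.
    rewrite uconsS dotZr dot_fvee_const cJ; congr (_ * (_ * _)).
    have : \prod_(j : 'I_n.+1) dot v (ucons u (fun _ : 'I_n => v) j) = c.
      by rewrite big_ord_recl ucons0 big1 ?mulr1 // => j _; rewrite uconsS vv.
    by rewrite (bigD1_ord (lift ord0 i)) //= uconsS vv mul1r.
  rewrite sumr_const card_ord mulr1 dot_nm -/U.
  rewrite mulrCA cc -[(_ * _) *+ n]mulr_natr -(rmorph_nat (real_complex R)).
  rewrite -!rmorphM -rmorphD -rmorphM /=; congr (_%:C)%C.
  by field; rewrite !gt_eqF ?ltr0n.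
(* All quantities but [c] are real and [c] enters only through |c|^2, so the squared norm becomes a
   real expression. *)
have aux (x y z N c2 : R) : c^* * c = (c2%:C)%C -> (x%:C * (x%:C * N%:C) -
    c * (x%:C * (y%:C * (z%:C * c^*%R))) - (c^*%R * (y%:C * (x%:C * (z%:C *
      c))) -
    c^*%R * (c * (y%:C * (y%:C * z%:C)))))%C =
    ((x * (x * N) - c2 * (x * (y * z)) -
      (c2 * (y * (x * z)) - c2 * (y * (y * z))))%:C)%C.
  by move=> c2E; rewrite 3!rmorphB /= !rmorphM /= -c2E; ring.
have nr j : nm (r j) ^+ 2 = eps j * q j.
  apply: (@complexI R); rewrite -dot_nm /r /pterm bZ.
  rewrite !(dotBl, dotBr, dotZl, dotZr) nbf dot_pow eqxx mul1r !conjR.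
  have bx : dot (b (fvee F (nseq j v))) (fvee F (nseq j.+1 v)) =
      ((w j.+1 ^+ 2)%:C)%C * c^*.
    rewrite bf fvee_nseq dotJ dot_fvee_const conjM conjR; congr (_ * _^*).
    by rewrite big_ord_recl ucons0 big1 ?mulr1 // => i _; rewrite uconsS vv.
  rewrite [dot (fvee F (nseq j.+1 v)) _]dotJ bx conjM conjCK conjR.
  rewrite (aux _ _ _ _ _ cc); congr (_%:C)%C; rewrite /eps /rho /q.
  by field; rewrite !gt_eqF ?ltr0n.
have eps0 : eps @ \oo --> (0 : R).
  have -> : 0 = 1 * (U - C) * 0 + C * (1 - 1) ^+ 2 * 1^-1 :> R by ring.
  apply: cvgD.
    apply: cvgM; last exact: cvg_harmonic.
    by apply: cvgMr_tmp.
  apply: cvgM; last by apply: cvgV; rewrite ?oner_eq0.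
  apply: cvgMl_tmp; apply: (cvgM (f := fun j => rho j - 1));
    apply: cvgB => //; exact: cvg_cst.
have r_ortho i j : i != j -> dot (r i) (r j) = 0.
  move=> ij; rewrite /r /pterm bZ [b (_ *: _)]bZ bf [b (fvee F (nseq j v))]bf.
  rewrite !fvee_nseq !(dotBl, dotBr, dotZl, dotZr).
  by rewrite !dot_ffvee_neq ?eqSS // !mulr0 !subr0.
have rK m : (fun N => \sum_(m <= j < N) r j) @ \oo -->
    b (cohvec v m) - c *: cohvec v m.+1.
  have -> : (fun N => \sum_(m <= j < N) r j) = (fun N =>
      b (\sum_(m <= j < N) pterm v j) - c *: \sum_(m.+1 <= j < N.+1) pterm v j).
    apply/funext => N; rewrite /r sumrB (linear_sumP lb) scaler_sumr.
    by rewrite [in RHS]big_add1.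
  apply: cvgB; first exact: bounded_cvg (@cohvec_cvg m).
  apply: cvgZl_tmp; have := @cohvec_cvg m.+1.
  by rewrite -(cvg_shiftS (fun N => \sum_(m.+1 <= j < N) pterm v j)).
move=> e e0; have d1 : 0 < nm c + 1 by have := nm_ge0 c; lra.
have e20 : 0 < e / 2 by rewrite divr_gt0.
have e22 : 0 < (e / 2) ^+ 2 by rewrite exprn_gt0.
have [N1 _ h1] := pterm_small (divr_gt0 e20 d1).
have [N2 _ h2] := (cvgr_lt 0 eps0) _ e22.
exists (maxn N1 N2) => // m /=; rewrite geq_max => /andP[m1 m2].
(* Half of the error is spent on the series of defects, half on the lowest term left over by the
   shift of degree. *)
have -> : b (cohvec v m) - c *: cohvec v m =
    (b (cohvec v m) - c *: cohvec v m.+1) - c *: pterm v m.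
  by rewrite [in LHS](cohvecS m) scalerDr opprD addrA addrAC (cohvecS m).
apply: (le_trans (nmD _ _)); rewrite nmN nmZ.
have A : nm (b (cohvec v m) - c *: cohvec v m.+1) <= e / 2 * nm (cohvec v m).
  rewrite nm_cohvec; apply: (ortho_series_bound (ltW e20) r_ortho _ (@rK m)).
  move=> j mj; rewrite nr ler_pM2r ?q_gt0 // ltW //; apply: h2.
  exact: leq_trans mj.
have B := h1 m m1; have D := cohvec_decr m.
have B' : nm c * nm (pterm v m) <= e / 2 * nm (cohvec v m).
  have : (nm c + 1) * nm (pterm v m) <= e / 2 * nm (cohvec v m.+1).
    by rewrite mulrC -ler_pdivlMr // mulrAC.
  have : e / 2 * nm (cohvec v m.+1) <= e / 2 * nm (cohvec v m).
    by rewrite ler_pM2l.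
  by have := nm_ge0 (pterm v m); rewrite mulrDl mul1r; lra.
have -> : e * nm (cohvec v m) =
    e / 2 * nm (cohvec v m) + e / 2 * nm (cohvec v m) by field.
by lra.
Qed.

End UnitVector.

End ApproximateEigenvectors.

(** * The weights exp(tau n^p) *)

Section Weights.
Variables (R : realType) (tau p : R).
Hypotheses (tau_gt0 : 0 < tau) (p_gt0 : 0 < p) (p_lt1 : p < 1).

Local Notation w := (weight tau p).
Local Notation D n := (n.+1%:R `^ p - n%:R `^ p).

Lemma weight_gt0 n : 0 < w n.
Proof. exact: expR_gt0. Qed.

Lemma powR_increment n : 0 <= D n.
Proof.
by rewrite subr_ge0 ge0_ler_powR ?nnegrE ?ler0n ?ler_nat // ltW.
Qed.

(* (n+1)^p = n^p (1 + 1/n)^p <= n^p (1 + 1/n) since p <= 1 *)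
Lemma powR_increment_le n : (0 < n)%N -> D n <= (n%:R `^ (1 - p))^-1.
Proof.
move=> n0; have x0 : 0 < n%:R :> R by rewrite ltr0n.
rewrite -natr1; move: (n%:R) x0 => x x0.
have -> : x + 1 = x * (1 + x^-1) by field; rewrite gt_eqF.
have ix0 : 0 < x^-1 by rewrite invr_gt0.
rewrite powRM ?(ltW x0) //; last by rewrite addr_ge0 // ltW.
have le1 : (1 + x^-1) `^ p <= 1 + x^-1 by apply: ler1_powR; rewrite ?lerDl ltW.
have xp : 0 < x `^ p by rewrite powR_gt0.
have -> : (x `^ (1 - p))^-1 = x `^ p * x^-1.
  rewrite powRB; last by rewrite (gt_eqF x0) implybT.
  by rewrite powRr1 ?(ltW x0) // invf_div.
have : x `^ p * (1 + x^-1) `^ p <= x `^ p * (1 + x^-1) by rewrite ler_pM2l.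
by rewrite mulrDr mulr1; lra.
Qed.

Lemma powR_increment_le1 n : D n <= 1.
Proof.
case: n => [|n]; first by rewrite powR0 ?gt_eqF // powR1 subr0.
apply: (le_trans (powR_increment_le (ltn0Sn n))).
rewrite invf_le1 ?powR_gt0 ?ltr0n //.
rewrite -[leLHS](powRr0 (n.+1%:R)); apply: ler_powR; first by rewrite ler1n.
by rewrite subr_ge0 ltW.
Qed.

(** The increments of n^p are at most 1, whence the constant e^tau in the bound for creation
    operators. *)
Lemma weight_growth n : w n.+1 <= expR tau * w n.
Proof.
rewrite -expRD ler_expR -[in leRHS](mulr1 tau) -[in leRHS]mulrA mul1r -mulrDr.
by rewrite ler_pM2l //; have := powR_increment_le1 n; lra.
Qed.

Lemma powR_increment_cvg : (fun n => D n) @ \oo --> (0 : R).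
Proof.
apply/cvgrPdist_le => e e0.
(* The threshold at which y^(1-p) = 1/e. *)
pose y : R := e^-1 `^ (1 - p)^-1.
near=> n.
have n0 : (0 < n)%N by near: n; exact: nbhs_infty_gt.
have yn : y <= n%:R.
  by near: n; exact: nbhs_infty_ger.
rewrite sub0r normrN ger0_norm ?powR_increment //.
apply: (le_trans (powR_increment_le n0)).
rewrite -[leRHS]invrK lef_pV2 ?posrE ?powR_gt0 ?invr_gt0 ?ltr0n //.
have -> : e^-1 = y `^ (1 - p).
  by rewrite /y -powRrM mulVf ?powRr1 ?invr_ge0 ?(ltW e0) // subr_eq0 gt_eqF.
by apply: ge0_ler_powR; rewrite ?nnegrE ?powR_ge0 ?ler0n // subr_ge0 ltW.
Unshelve. all: by end_near. Qed.

Lemma weight_ratio_cvg : (fun n => w n.+1 ^+ 2 / w n ^+ 2) @ \oo --> (1 : R).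
Proof.
have -> : (fun n => w n.+1 ^+ 2 / w n ^+ 2) = fun n => expR (2 * tau * D n).
  apply/funext => n; rewrite /weight -!expRM_natl -expRB; congr expR.
  by rewrite [in RHS]mulrBr !mulrA.
rewrite -[X in _ --> X]expR0; apply: continuous_cvg;
  first exact: continuous_expR.
rewrite -[X in _ --> X](mulr0 (2 * tau)).
by apply: cvgMl_tmp; exact: powR_increment_cvg.
Qed.

(* exp(z) >= z^k / k! with k p >= 2 *)
Lemma weight_summable : cvgn (series (fun n => (w n ^+ 2)^-1)).
Proof.
pose q n := (w n ^+ 2)^-1.
have q0 n : 0 < q n by rewrite invr_gt0 exprn_gt0 ?weight_gt0.
have [k kp] : exists k : nat, 2 <= p * k.+1%:R.
  exists (Num.truncn (2 / p)); rewrite mulrC -ler_pdivrMr // ltW //.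
  exact: truncnS_gt.
(* With z = n^p >= 1 the term of order k + 1 of exp(2 tau z) is z^(k+1) / c, which is at least n^2 /
   c. *)
pose c : R := k.+1`!%:R / (2 * tau) ^+ k.+1.
have c0 : 0 < c by rewrite divr_gt0 ?exprn_gt0 ?ltr0n ?fact_gt0 // mulr_gt0.
have qc n : q n.+1 <= c / n.+1%:R ^+ 2.
  have -> : c / n.+1%:R ^+ 2 = (c^-1 * n.+1%:R ^+ 2)^-1.
    by rewrite [RHS]invfM invrK.
  rewrite /q lef_pV2 ?posrE ?exprn_gt0 ?weight_gt0 ?mulr_gt0 ?invr_gt0
    ?exprn_gt0 ?ltr0n //.
  rewrite /weight -expRM_natl mulrA.
  set z : R := n.+1%:R `^ p.
  have z0 : 0 <= 2 * tau * z.
    by rewrite mulr_ge0 ?powR_ge0 // mulr_ge0 // ltW.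
  have := expR_ge1Dxn k z0; apply: le_trans.
  have -> : c^-1 * n.+1%:R ^+ 2 = (2 * tau) ^+ k.+1 / k.+1`!%:R * n.+1%:R ^+ 2.
    by rewrite /c invf_div.
  rewrite [(2 * tau * z) ^+ _]exprMn.
  apply: (@le_trans _ _ ((2 * tau) ^+ k.+1 * z ^+ k.+1 / k.+1`!%:R));
    last first.
    by rewrite lerDr.
  rewrite [leLHS]mulrAC ler_pM2r ?invr_gt0 ?ltr0n ?fact_gt0 // ler_pM2l;
    last first.
    by rewrite exprn_gt0 ?mulr_gt0.
  rewrite /z -(powR_mulrn k.+1) ?powR_ge0 // -powRrM -(powR_mulrn 2) ?ler0n //.
  by apply: ler_powR; rewrite ?ler1n.
apply: nondecreasing_is_cvgn.
  by apply: nondecreasing_series => n _ _; exact: ltW (q0 n).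
exists (q 0 + 2 * c) => _ [n _ <-].
(* Telescoping bound from 1/x^2 <= 2 (1/x - 1/(x+1)), valid for x >= 1. *)
have bnd N : series q N.+1 <= q 0 + 2 * c * (1 - N.+1%:R^-1).
  elim: N => [|N ih].
    by rewrite seriesSr /series /= big_geq // add0r invr1 subrr mulr0 addr0.
  rewrite seriesSr; have := qc N; have : 0 < N.+1%:R :> R by rewrite ltr0n.
  rewrite -(natr1 N.+1); move: ih; set x : R := N.+1%:R => ih x0 qx.
  have : 1 <= x by rewrite ler1n.
  move=> x1.
  have key : c / x ^+ 2 <= 2 * c * (x^-1 - (x + 1)^-1).
    have -> : 2 * c * (x^-1 - (x + 1)^-1) = c / x ^+ 2 * (2 * x / (x + 1)).
      by field; rewrite !gt_eqF //; lra.
    have a0 : 0 <= c / x ^+ 2 by rewrite ltW // divr_gt0 ?exprn_gt0.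
    have x10 : 0 < x + 1 by rewrite addr_gt0.
    by rewrite ler_peMr // ler_pdivlMr //; lra.
  move: key ih qx; move: (c / x ^+ 2) (x^-1) ((x + 1)^-1) (q N.+1) => a b d e.
  by move: (series q N.+1) (q 0) => s t; lra.
case: n => [|n].
  have := q0 0; have -> : series q 0 = 0 by rewrite /series /= big_geq.
  by lra.
apply: (le_trans (bnd n)); rewrite lerD2l.
have : 0 <= n.+1%:R^-1 :> R by rewrite invr_ge0 ler0n.
by move: (_^-1) => y y0; have := mulr_ge0 (ltW c0) y0; lra.
Qed.

End Weights.

(** * Complex-valued curves *)

Section ComplexCurves.
Variable R : realType.

(** The variable is real, so the derivative is taken separately on real and imaginary parts. *)
Definition cderive (G G' : R -> cplx R) (t : R) : Prop :=
  is_derive t (1 : R) (fun s => complex.Re (G s)) (complex.Re (G' t)) /\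
  is_derive t (1 : R) (fun s => complex.Im (G s)) (complex.Im (G' t)).

Lemma ReM (a b : cplx R) : complex.Re (a * b) =
  complex.Re a * complex.Re b - complex.Im a * complex.Im b.
Proof. by case: a b => [a a'] [b b']. Qed.

Lemma ImM (a b : cplx R) : complex.Im (a * b) =
  complex.Re a * complex.Im b + complex.Im a * complex.Re b.
Proof. by case: a b => [a a'] [b b']. Qed.

Lemma ImD (a b : cplx R) : complex.Im (a + b) = complex.Im a + complex.Im b.
Proof. by case: a b => [a a'] [b b']. Qed.

Lemma Re_conj (a : cplx R) : complex.Re a^* = complex.Re a.
Proof. by rewrite -[a^*]/(conjc a); case: a. Qed.

Lemma Im_conj (a : cplx R) : complex.Im a^* = - complex.Im a.
Proof. by rewrite -[a^*]/(conjc a); case: a. Qed.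

Lemma cderive_cst (c : cplx R) t : cderive (fun=> c) (fun=> 0) t.
Proof. by split; exact: is_derive_cst. Qed.

Lemma cderive_conj G G' t : cderive G G' t ->
  cderive (fun s => (G s)^*) (fun s => (G' s)^*) t.
Proof.
move=> [dr di]; split; rewrite ?Re_conj ?Im_conj.
  by under eq_fun do rewrite Re_conj.
by under eq_fun do rewrite Im_conj; exact: is_deriveN.
Qed.

Lemma cderiveD G1 G1' G2 G2' t : cderive G1 G1' t -> cderive G2 G2' t ->
  cderive (fun s => G1 s + G2 s) (fun s => G1' s + G2' s) t.
Proof.
move=> [dr di] [dr' di']; split; rewrite ?ReD ?ImD.
  by under eq_fun do rewrite ReD; exact: is_deriveD.
by under eq_fun do rewrite ImD; exact: is_deriveD.
Qed.

Lemma cderiveM G1 G1' G2 G2' t : cderive G1 G1' t -> cderive G2 G2' t ->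
  cderive (fun s => G1 s * G2 s) (fun s => G1' s * G2 s + G1 s * G2' s) t.
Proof.
move=> [dr di] [dr' di']; split; rewrite ?ReD ?ImD ?ReM ?ImM.
  under eq_fun do rewrite ReM.
  have hd := is_deriveB (is_deriveM dr dr') (is_deriveM di di').
  by apply: (is_derive_eq hd); rewrite /GRing.scale /=; ring.
under eq_fun do rewrite ImM.
have hd := is_deriveD (is_deriveM dr di') (is_deriveM di dr').
by apply: (is_derive_eq hd); rewrite /GRing.scale /=; ring.
Qed.

(* The mean value theorem applied to Re (conj D * G) with D = G b - G a. *)
Lemma cderive_lipschitz G G' (a b : R) :
  (forall t, cderive G G' t) -> (forall t, nm (G' t) <= 1) ->
  nm (G b - G a) <= `|b - a|.
Proof.
move=> dG G1.
wlog ab : a b / a <= b.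
  move=> h; have [ab|/ltW ba] := leP a b; first exact: h.
  by rewrite nmB distrC; exact: h.
set D := G b - G a; apply: nm_sqr_le => //.
pose K s := D^* * G s; pose K' s := D^* * G' s.
have dK t : is_derive t (1 : R) (fun s => complex.Re (K s)) (complex.Re (K' t)).
  have [+ _] := cderiveM (cderive_cst D^* t) (dG t).
  by rewrite mul0r add0r.
have cK : {within `[a, b], continuous (fun s => complex.Re (K s))}.
  apply: continuous_subspaceT => t; apply: differentiable_continuous.
  by apply/derivable1_diffP; case: (dK t).
have <- : complex.Re (K b) - complex.Re (K a) = nm D ^+ 2.
  by rewrite -ReN -ReD /K -mulrBr -/D -normCKC nmE -rmorphXn.
have [c cab ->] := MVT_segment ab (fun t _ => dK t) cK.
rewrite mulrC (ger0_norm (_ : 0 <= b - a)) ?subr_ge0 //.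
rewrite ler_wpM2l ?subr_ge0 //; apply: (le_trans (ler_norm _)).
apply: (le_trans (Re_le_nm _)); rewrite /K' nmM nm_conj.
by rewrite -[leRHS]mulr1 ler_wpM2l ?nm_ge0.
Qed.

End ComplexCurves.

(** * Functions along the flow *)

Section Flow.
Variables (R : realType) (d : nat) (X : topologicalType).
Variables (M : manifold R d X) (V : vector_field M) (Phi : R -> X -> X).
Hypothesis hPhi : is_flow V Phi.

(** The factorisation through the chart holds only while the orbit stays in its domain; this is a
    neighbourhood of [t], which suffices for the derivative. *)
Lemma flow_chain_rule (x : X) (t : R) (phi : X -> R) :
  let z := Phi t x in let c := mf_chart M (mf_at M z) in
  smooth_on (chart_map c @` chart_dom c) (fun p => phi (chart_inv c p)) ->
  is_derive t (1 : R) (fun s => phi (Phi s x))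
    ('D_(vf_comp V (mf_at M z) z) (fun p =>
      phi (chart_inv c p)) (chart_map c z)).
Proof.
move=> z c smooth; have zc : chart_dom c z by exact: mf_at_dom.
have [dphi _] := smooth 1; have {}dphi := dphi (chart_map c z) (imageP _ zc).
have [dg gE] := flow_generator hPhi zc.
apply: (@near_eq_is_derive _ _ _
  ((fun p => phi (chart_inv c p)) \o (fun s => chart_map c (Phi s x)))).
  have : \forall s \near t, chart_dom c (Phi s x).
    have fc : (fun s => Phi s x) @ t --> Phi t x by exact: (flow_cont hPhi).
    apply: (fc (chart_dom c)); apply: open_nbhs_nbhs; split=> //.
    exact: chart_domO.
  by apply: filterS => s sc; rewrite /= chart_mapK.
move: dg => /derivable1_diffP dg.
have dc : differentiable ((fun p => phi (chart_inv c p)) \o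
    (fun s => chart_map c (Phi s x))) t by exact: differentiable_comp.
apply: DeriveDef; first exact: diff_derivable.
rewrite -gE [RHS]deriveE // [X in 'd _ _ X]deriveE // deriveE // diff_comp //.
Qed.

(** [vf_der] at a point uses the chart chosen there, so the chain rule is applied in the chart
    attached to [Phi t x]. *)
Lemma flow_cderive (H : hilbertType R) (k : X -> H) (f g : H) (x : X) (t : R) :
  is_rkhs M k -> Vgraph V k f g ->
  cderive (fun s => dot (k (Phi s x)) f) (fun s => dot (k (Phi s x)) g) t.
Proof.
move=> hk fg; have [sr si] := rkhs_smooth hk f (mf_at M (Phi t x)).
have gE : dot (k (Phi t x)) g = vf_der V (rk_eval k f) (Phi t x).
  by rewrite -fg.
split; rewrite gE.
  exact: (flow_chain_rule (phi := fun y => complex.Re (rk_eval k f y))).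
exact: (flow_chain_rule (phi := fun y => complex.Im (rk_eval k f y))).
Qed.

(** Points are closed in a Hausdorff space, so the times from [y] to [x] form a closed set; cut down
    to [-|T|, |T|] it is compact and |t| attains its minimum. *)
Lemma flow_min_time (x y : X) : (exists t : R, x = Phi t y) ->
  exists t0 : R, x = Phi t0 y /\ forall t : R, x = Phi t y -> `|t0| <= `|t|.
Proof.
move=> [T xT].
pose A := `[- `|T|, `|T|]%classic `&` [set t | x = Phi t y].
have clA : closed [set t | x = Phi t y].
  have -> : [set t | x = Phi t y] = (fun t => Phi t y) @^-1` [set x].
    by apply/seteqP; split=> t /=.
  apply: preimage_closed => [t _|]; first exact: (flow_cont hPhi).
  exact/accessible_closed_set1/hausdorff_accessible/(mf_hausdorff M).
have cA : compact A.
  by apply: compact_closedI clA; exact: segment_compact.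
have A0 : A !=set0.
  by exists T; split=> //=; rewrite in_itv /= -ler_norml.
have [|t0 /set_mem[t0T xt0] mt0] :=
  @compact_EVT_min _ R (fun t => `|t|) A A0 cA.
  by apply: continuous_subspaceT => t; exact: norm_continuous.
exists t0; split=> // t xt.
have [tT|Tt] := leP `|t| `|T|.
  by apply: mt0; apply/mem_set; split=> //=; rewrite in_itv /= -ler_norml.
by move: t0T; rewrite /= in_itv /= -ler_norml => /le_trans; apply; exact: ltW.
Qed.

End Flow.

(** * Algebra of approximate eigenvalues *)

Section NearEigenAlgebra.
Variables (R : realType) (h : hilbertType R).
Variable T : forall n, tensor_power h n.
Variables (w : nat -> R) (F : fock T w) (v : h).
Implicit Types (a b : F -> F).

Lemma near_eigen_id : near_eigen v (id : F -> F) 1.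
Proof.
move=> e e0; near=> m; rewrite scale1r subrr nm0.
by rewrite mulr_ge0 ?nm_ge0 // ltW.
Unshelve. all: by end_near. Qed.

Lemma near_eigen_0 : near_eigen v (fun=> 0 : F) 0.
Proof.
move=> e e0; near=> m; rewrite scale0r subrr nm0.
by rewrite mulr_ge0 ?nm_ge0 // ltW.
Unshelve. all: by end_near. Qed.

Lemma near_eigen_lin (c : cplx R) a b x y :
  near_eigen v a x -> near_eigen v b y ->
  near_eigen v (fun eta => c *: a eta + b eta) (c * x + y).
Proof.
move=> ax by_ e e0; have c1 : 0 < nm c + 1 by have := nm_ge0 c; lra.
have eE : e = (nm c + 1) * (e / (nm c + 1) / 2) * 2 by field; rewrite gt_eqF.
have : 0 < e / (nm c + 1) / 2 by rewrite !divr_gt0.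
move: (e / _ / _) eE => d eE d0.
apply: filterS2 (ax _ d0) (by_ _ d0) => m.
set K := cohvec F v m => am bm.
have -> : c *: a K + b K - (c * x + y) *: K =
    c *: (a K - x *: K) + (b K - y *: K).
  by rewrite scalerDl opprD addrACA scalerBr scalerA.
apply: (le_trans (nmD _ _)); rewrite nmZ.
have : nm c * nm (a K - x *: K) <= nm c * (d * nm K).
  by rewrite ler_wpM2l ?nm_ge0.
rewrite eE; have := mulr_ge0 (ltW d0) (nm_ge0 K).
have := mulr_ge0 (nm_ge0 c) (mulr_ge0 (ltW d0) (nm_ge0 K)).
by move: am bm; lra.
Qed.

(** a b K - x y K = a (b K - y K) + y (a K - x K); boundedness of [a] controls the first summand.
    This is the source of the multiplicativity of the limit states. *)
Lemma near_eigen_comp a b x y : bounded_op a ->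
  near_eigen v a x -> near_eigen v b y -> near_eigen v (a \o b) (x * y).
Proof.
move=> [la [C C0 ba]] ax by_ e e0; have [_ _ aB aZ] := linear_spec la.
have c1 : 0 < C + nm y + 1 by have := nm_ge0 y; lra.
have eE : e = (C + nm y + 1) * (e / (C + nm y + 1)) by field; rewrite gt_eqF.
have : 0 < e / (C + nm y + 1) by rewrite divr_gt0.
move: (e / _) eE => d eE d0.
apply: filterS2 (ax _ d0) (by_ _ d0) => m /=.
set K := cohvec F v m => am bm.
have -> : a (b K) - (x * y) *: K = a (b K - y *: K) + y *: (a K - x *: K).
  by rewrite aB aZ scalerBr scalerA [y * x]mulrC addrA subrK.
apply: (le_trans (nmD _ _)); rewrite nmZ.
have : nm y * nm (a K - x *: K) <= nm y * (d * nm K).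
  by rewrite ler_wpM2l ?nm_ge0.
have : nm (a (b K - y *: K)) <= C * (d * nm K).
  by apply: (le_trans (ba _)); rewrite ler_wpM2l.
rewrite eE; have := mulr_ge0 (ltW d0) (nm_ge0 K).
by rewrite !mulrDl mul1r -!mulrA; lra.
Qed.

Lemma bounded_id : bounded_op (id : F -> F).
Proof. by split=> //; exists 1 => // x; rewrite mul1r. Qed.

Lemma bounded_0 : bounded_op (fun _ : F => 0 : F).
Proof.
split; first by move=> c x y; rewrite scaler0 addr0.
by exists 0 => // x; rewrite nm0 mul0r.
Qed.

Lemma bounded_lin (c : cplx R) a b : bounded_op a -> bounded_op b ->
  bounded_op (fun eta => c *: a eta + b eta).
Proof.
move=> [la [A A0 ba]] [lb [B B0 bb]]; split.
  move=> t x y; rewrite la lb !scalerDr !scalerA [c * t]mulrC.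
  by rewrite addrACA.
exists (nm c * A + B); first by rewrite addr_ge0 ?mulr_ge0 ?nm_ge0.
move=> x; apply: (le_trans (nmD _ _)); rewrite nmZ mulrDl lerD //.
by rewrite -mulrA ler_wpM2l ?nm_ge0.
Qed.

Lemma bounded_comp a b : bounded_op a -> bounded_op b -> bounded_op (a \o b).
Proof.
move=> [la [A A0 ba]] [lb [B B0 bb]]; split.
  by move=> t x y; rewrite /= lb la.
exists (A * B); first by rewrite mulr_ge0.
by move=> x; apply: (le_trans (ba _)); rewrite -mulrA ler_wpM2l.
Qed.

End NearEigenAlgebra.

(** * Approximation of symmetric powers *)

Section PowerApproximation.
Variables (R : realType) (h : hilbertType R).
Variable T : forall n, tensor_power h n.
Variables (w : nat -> R) (F : fock T w).

Lemma approx_seq (V : normedModType (cplx R)) (A : set V) (x : V) :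
  approx A x -> exists2 u : nat -> V, (forall j, A (u j)) & u @ \oo --> x.
Proof.
move=> ax; have /choice[u hu] (j : nat) :
  exists a, A a /\ nm (x - a) < j.+1%:R^-1.
  have j0 : 0 < j.+1%:R^-1 :> R by rewrite invr_gt0 ltr0n.
  by have [a Aa xa] := ax _ j0; exists a.
exists u; first by move=> j; case: (hu j).
apply/cvg_nmP => e e0; apply: filterS (near_infty_natSinv_lt (PosNum e0)) => j.
by apply: lt_trans; case: (hu j).
Qed.

Lemma dot_cvgr (y x : h) (u : nat -> h) :
  u @ \oo --> x -> (fun j => dot y (u j)) @ \oo --> dot y x.
Proof.
move=> /cvg_nmP ux; apply/cvg_nmP => e e0.
have y1 : 0 < nm y + 1 by have := nm_ge0 y; lra.
apply: filterS (ux _ (divr_gt0 e0 y1)) => j; rewrite ltr_pdivlMr // => uj.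
rewrite -dotBr; apply: (le_lt_trans (nm_dot _ _)).
by move: uj; have := nm_ge0 (x - u j); nra.
Qed.

Lemma dot_cvg_diag (x : h) (u : nat -> h) :
  u @ \oo --> x -> (fun j => dot (u j) (u j)) @ \oo --> dot x x.
Proof.
move=> ux; have /cvg_nmP ux' := ux.
have h1 : (fun j => dot (x - u j) (x - u j)) @ \oo --> (0 : cplx R).
  (* A distance below both e and 1 has its square below e. *)
  apply/cvg_nmP => e e0; have e1 : 0 < Num.min e 1 by rewrite lt_min e0 /=.
  apply: filterS (ux' _ e1) => j; rewrite lt_min => /andP[uj u1].
  rewrite sub0r nmN; apply: (le_lt_trans (nm_dot _ _)).
  by have := nm_ge0 (x - u j); nra.
have h2 : (fun j => dot x (u j)) @ \oo --> dot x x by exact: dot_cvgr.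
have h3 : (fun j => (dot x (u j))^*) @ \oo --> (dot x x)^*.
  apply/cvg_nmP => e e0; apply: filterS ((cvg_nmP _ _).1 h2 _ e0) => j.
  by rewrite -rmorphB nm_conj.
have -> : (fun j => dot (u j) (u j)) = fun j =>
    dot (x - u j) (x - u j) + dot x (u j) + (dot x (u j))^* - dot x x.
  by apply/funext => j; rewrite !(dotBl, dotBr) -dotJ; ring.
have xE : dot x x = 0 + dot x x + (dot x x)^* - dot x x.
  by rewrite -dotJ add0r addrK.
rewrite [X in _ --> X]xE.
by apply: cvgB; [apply: cvgD h3; exact: cvgD h1 h2|exact: cvg_cst].
Qed.

Lemma cplx_cvgX (u : nat -> cplx R) (x : cplx R) n :
  u @ \oo --> x -> (fun j => u j ^+ n) @ \oo --> x ^+ n.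
Proof.
move=> ux; elim: n => [|n ih]; first exact: cvg_cst.
have h1 : (fun j => u j * u j ^+ n) @ \oo --> x * x ^+ n by exact: (cvgM ux ih).
rewrite -exprS in h1; apply: cvg_trans h1.
by apply: near_eq_cvg; apply: nearW => j; rewrite exprS.
Qed.

(** The inner product of two n-th powers is w(n)^2 <x, y>^n, so the squared distance between powers
    is a polynomial in inner products that converge. *)
Lemma approx_power (A : set h) (v : h) n : approx A v ->
  approx [set ffvee F (fun _ : 'I_n => u) | u in A] (ffvee F (fun _ : 'I_n =>
    v)).
Proof.
move=> /approx_seq[u Au uv].
pose f (x : h) : F := ffvee F (fun _ : 'I_n => x).
have fE x y : dot (f x) (f y) = ((w n ^+ 2)%:C)%C * dot x y ^+ n.
  by rewrite dot_fvee_const prodr_const card_ord.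
have fcvg : (fun j => dot (f v - f (u j)) (f v - f (u j))) @ \oo --> (0 : cplx
  R).
  pose W : cplx R := ((w n ^+ 2)%:C)%C.
  have conjX (a : cplx R) : (a ^+ n)^* = a^* ^+ n by exact: rmorphXn.
  have zE : 0 = W * dot v v ^+ n - W * dot v v ^+ n -
      (W * (dot v v ^+ n)^* - W * dot v v ^+ n) :> cplx R.
    by rewrite conjX -dotJ !subrr.
  rewrite [X in _ --> X]zE.
  have -> : (fun j => dot (f v - f (u j)) (f v - f (u j))) = fun j =>
      W * dot v v ^+ n - W * dot v (u j) ^+ n -
      (W * (dot v (u j) ^+ n)^* - W * dot (u j) (u j) ^+ n).
    by apply/funext => j; rewrite !(dotBl, dotBr) !fE conjX -dotJ.
  have h1 : (fun j => dot v (u j) ^+ n) @ \oo --> dot v v ^+ n.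
    by apply: cplx_cvgX; exact: dot_cvgr.
  have h2 : (fun j => dot (u j) (u j) ^+ n) @ \oo --> dot v v ^+ n.
    by apply: cplx_cvgX; exact: dot_cvg_diag.
  have h3 : (fun j => (dot v (u j) ^+ n)^*) @ \oo --> (dot v v ^+ n)^*.
    apply/cvg_nmP => e e0; apply: filterS ((cvg_nmP _ _).1 h1 _ e0) => j.
    by rewrite -rmorphB nm_conj.
  have WM (g : nat -> cplx R) l : g @ \oo --> l ->
      (fun j => W * g j) @ \oo --> W * l by move=> gl;
        exact: (cvgM (cvg_cst W) gl).
  exact: (cvgB (cvgB (cvg_cst _) (WM _ _ h1)) (cvgB (WM _ _ h3) (WM _ _ h2))).
move=> e e0; have e2 : 0 < e ^+ 2 by rewrite exprn_gt0.
have [N _ hN] := (cvg_nmP _ _).1 fcvg _ e2.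
exists (f (u N)); first by exists (u N).
have := hN N (leqnn N); rewrite sub0r nmN dot_nm nmC ger0_norm ?exprn_ge0
  ?nm_ge0 //.
by rewrite ltr_pXn2r ?nnegrE ?nm_ge0 // ltW.
Qed.

End PowerApproximation.

(** * The operators of A_n and the limit states *)

Section StarAlgebra.
Variables (R : realType) (d : nat) (X : topologicalType).
Variables (M : manifold R d X) (V : vector_field M) (Phi : R -> X -> X).
Hypothesis hPhi : is_flow V Phi.
Variables (H : hilbertType R) (k : X -> H).
Hypothesis hk : is_rkhs M k.
Variable Hinf : set H.
Hypothesis h1 : assumption1 V k Hinf.
Hypothesis h3 : forall x : X, `|k x| = 1.
Variables (l2 : ell2 R) (hh : tensor_product l2 H).
Variable T : forall j : nat, tensor_power hh j.
Variables (tau p : R).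
Hypotheses (htau : 0 < tau) (hp0 : 0 < p) (hp1 : p < 1).
Variable F : fock T (weight tau p).

Local Notation L := (Lop V k Hinf hh).
Local Notation D := (Dgraph F (h0 hh Hinf) L).
Let vec x : hh := tp hh (ell2_e l2 0) (k x).
Let w_gt0 := weight_gt0 tau p.
Let w_growth := weight_growth htau hp0 hp1.
Let w_sum : cvgn (series (fun n => (weight tau p n ^+ 2)^-1)) :=
  weight_summable htau hp0.
Let w_ratio : (fun n => weight tau p n.+1 ^+ 2 / weight tau p n ^+ 2) @ \oo
  --> (1 : R) := weight_ratio_cvg tau hp0 hp1.

Let vec_unit x : nm (vec x) = 1.
Proof.
apply/eqP; rewrite -(@eqrXn2 _ 2) ?nm_ge0 // expr1n; apply/eqP.
apply: (@complexI R); rewrite -dot_nm tp_dot ell2_dot eqxx mul1r dot_norm h3.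
by rewrite expr1n.
Qed.

(* [a] has a value [g x] in every state [Psi x], its commutator with [D] is a
   bounded operator with value [g' x], and [g'] is the derivative of [g] along
   the flow. *)
Definition differentiable_op (a : F -> F) : Prop :=
  exists (da : F -> F) (g g' : X -> cplx R),
  [/\ bounded_op a /\ bounded_op da,
      forall x y, D x y -> D (a x) (da x + a y),
      forall x, near_eigen (vec x) a (g x),
      forall x, near_eigen (vec x) da (g' x) &
      forall x t, cderive (fun s => g (Phi s x)) (fun s => g' (Phi s x)) t].

Lemma differentiable_id : differentiable_op id.
Proof.
exists (fun=> 0), (fun=> 1), (fun=> 0); split.
- by split; [exact: bounded_id|exact: bounded_0].
- by move=> x y; rewrite add0r.
- by move=> x; exact: near_eigen_id.
- by move=> x; exact: near_eigen_0.
- by move=> x t; exact: cderive_cst.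
Qed.

Lemma differentiable_lin (c : cplx R) a b :
  differentiable_op a -> differentiable_op b ->
  differentiable_op (fun eta => c *: a eta + b eta).
Proof.
move=> [da [ga [ga' [[ba bda] Da ea eda dga]]]].
move=> [db [gb [gb' [[bb bdb] Db eb edb dgb]]]].
exists (fun eta => c *: da eta + db eta), (fun x => c * ga x + gb x),
  (fun x => c * ga' x + gb' x); split.
- by split; exact: bounded_lin.
- move=> x y xy.
  have -> : c *: da x + db x + (c *: a y + b y) =
      c *: (da x + a y) + (db x + b y) by rewrite addrACA scalerDr.
  by apply: lin_ext_lin; [exact: Da|exact: Db].
- by move=> x; exact: near_eigen_lin.
- by move=> x; exact: near_eigen_lin.
- move=> x t; apply: cderiveD (dgb x t).
  have [dr di] := cderiveM (cderive_cst c t) (dga x t).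
  by move: dr di; rewrite !mul0r !add0r; split.
Qed.

Lemma differentiable_comp_op a b :
  differentiable_op a -> differentiable_op b -> differentiable_op (a \o b).
Proof.
move=> [da [ga [ga' [[ba bda] Da ea eda dga]]]].
move=> [db [gb [gb' [[bb bdb] Db eb edb dgb]]]].
(* The Leibniz rule [D, a b] = [D, a] b + a [D, b], written with a factor 1 to match the lemmas on
   linear combinations. *)
exists (fun eta => 1 *: (da \o b) eta + (a \o db) eta),
  (fun x => ga x * gb x), (fun x => 1 * (ga' x * gb x) + ga x * gb' x); split.
- split; first exact: bounded_comp.
  by apply: bounded_lin; exact: bounded_comp.
- move=> x y /Db/Da; have [_ aD _ _] := linear_spec ba.1.
  by rewrite /= aD scale1r addrA.
- by move=> x; exact: near_eigen_comp.
- by move=> x; apply: near_eigen_lin; exact: near_eigen_comp.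
- move=> x t; have := cderiveM (dga x t) (dgb x t).
  by rewrite /cderive mul1r.
Qed.

Lemma creation_op_exists u : exists b : F -> F, creation_op u b.
Proof.
have [b [lb bb bE]] := creation_exists F w_gt0 w_growth u.
exists b; split=> //; split=> //; exists (expR tau * nm u) => //.
by rewrite mulr_ge0 ?nm_ge0 // expR_ge0.
Qed.

Section Generators.
Variables (n : nat) (f : H).
Hypotheses (hn : (1 < n)%N) (ff : Hinf f).
Let u := En hh n f.

Let u_h0 : h0 hh Hinf u.
Proof. exact: (En_h0 V k). Qed.

Let vec_u x : dot (vec x) u = dot (k x) f.
Proof. by apply: dot_En; exact: ltnW. Qed.

Let vec_Lu x : dot (vec x) (L u) = dot (k x) (Vop V k f).
Proof. exact: (dot_LEn h1). Qed.

Let vec_cderive x t : cderive (fun s => dot (vec (Phi s x)) u)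
  (fun s => dot (vec (Phi s x)) (L u)) t.
Proof.
rewrite (_ : (fun s => dot _ u) = fun s => dot (k (Phi s x)) f); last first.
  by apply/funext => s; exact: vec_u.
rewrite (_ : (fun s => dot _ (L u)) = fun s => dot (k (Phi s x)) (Vop V k f)).
  exact: (flow_cderive hPhi _ _ hk (Vop_graph h1 ff)).
by apply/funext => s; exact: vec_Lu.
Qed.

Lemma differentiable_creation b : creation_op u b -> differentiable_op b.
Proof.
move=> cb; have [db cdb] := creation_op_exists (L u).
exists db, (fun x => dot (vec x) u), (fun x => dot (vec x) (L u)); split.
- by split; [exact: cb.1|exact: cdb.1].
- exact: (Dgraph_creation u_h0 cb cdb).
- by move=> x; exact: (near_eigen_creation w_gt0 w_sum w_ratio (vec_unit x) cb).
- by move=> x; exact: (near_eigen_creation w_gt0 w_sum w_ratio (vec_unit x)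
    cdb).
- exact: vec_cderive.
Qed.

Lemma differentiable_annihilation a b :
  creation_op u b -> adjoint a b -> differentiable_op a.
Proof.
move=> cb ab; have [db cdb] := creation_op_exists (L u).
have [da bda dadb] := annihilation_exists w_gt0 cdb.
exists da, (fun x => dot u (vec x)), (fun x => dot (L u) (vec x)); split.
- by split=> //; exact: adjoint_bounded cb ab.
- exact: (Dgraph_annihilation w_gt0 (fun y z => Lop_skew h1 (u := y) (v := z))
    u_h0 cb ab cdb dadb).
- move=> x.
  exact: (near_eigen_annihilation w_gt0 w_sum w_ratio (vec_unit x) cb ab).
- move=> x.
  exact: (near_eigen_annihilation w_gt0 w_sum w_ratio (vec_unit x) cdb dadb).
- move=> x t.
  rewrite (_ : (fun s => dot u _) = fun s => (dot (vec (Phi s x)) u)^*);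
    last first.
    by apply/funext => s; rewrite dotJ.
  rewrite (_ : (fun s => dot (L u) _) = fun s => (dot (vec (Phi s x)) (L u))^*).
    exact: cderive_conj.
  by apply/funext => s; rewrite dotJ.
Qed.

End Generators.

Lemma adjoint_sym (E : hilbertType R) (a b : E -> E) : adjoint a b ->
  adjoint b a.
Proof. by move=> ab x y; rewrite dotJ -ab -dotJ. Qed.

Lemma adjoint_unique (E : hilbertType R) (a b c : E -> E) :
  adjoint a b -> adjoint a c -> b = c.
Proof.
move=> ab ac; apply/funext => x; apply/eqP; rewrite -subr_eq0; apply/eqP.
by apply: dot_eq0; set z := (X in dot X _); rewrite dotBr -ab -ac subrr.
Qed.

(** Being differentiable is not visibly inherited by the adjoint, so the induction carries an
    adjoint [a'] that is differentiable as well. In the adjoint case the two exchange roles, since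
    adjoints are unique. *)
Lemma differentiable_An (S : set H) n a : (1 < n)%N -> S `<=` Hinf ->
  An S F n a -> differentiable_op a.
Proof.
move=> n1 SH aA; suff [a' [_ + _]] : exists a', [/\ adjoint a a',
  differentiable_op a & differentiable_op a'] by [].
elim: aA => {a} [a [f Sf [b [lb cb bE] ab]]||c a b _ [a' [aa da da']] _
    [b' [bb db db']]|a b _ [a' [aa da da']] _ [b' [bb db db']]
  |a b _ [a' [aa da da']] ab].
- have crb : creation_op (En hh n f) b.
    by split=> //; exact: linear_continuous_bounded.
  have ff := SH _ Sf; exists b; split=> //.
    exact: (differentiable_annihilation n1 ff crb ab).
  exact: (differentiable_creation n1 ff crb).
- by exists id; split=> //; exact: differentiable_id.
- exists (fun eta => c^* *: a' eta + b' eta); split;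
    try exact: differentiable_lin.
  by move=> x y; rewrite dotDl dotZl dotDr dotZr aa bb.
- exists (b' \o a'); split; try exact: differentiable_comp_op.
  by move=> x y; rewrite /= aa bb.
- exists a; split=> //; first exact: adjoint_sym.
  by rewrite (adjoint_unique ab aa).
Qed.

(** Partial sums have finitely many degrees; in each of them k_x is replaced by a nearby vector of
    the dense subspace [Hinf], and the power then lies in the domain. *)
Lemma cohvec_approx x m : approx (op_dom D) (cohvec F (vec x) m).
Proof.
rewrite /Dgraph lin_ext_dom; apply: approx_approx => e e0.
have [N _ hN] := (cvg_nmP _ _).1 (@cohvec_cvg _ _ _ _ F w_gt0 w_sum _
  (vec_unit x) m) e e0.
exists (\sum_(m <= j < N) pterm F (vec x) j); last exact: (hN N (leqnn N)).
elim/big_ind: _ => [|y z ay az|j _].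
- exact/approx_sub/span0.
- by rewrite -[y]scale1r; exact: approx_lin.
rewrite /pterm -[_ *: _]addr0; apply: approx_lin; last exact/approx_sub/span0.
have ax : approx [set tp hh (ell2_e l2 0) f | f in Hinf] (vec x).
  move=> r r0; have [f ff xf] := dense_approx (k x) (a1_dense h1) r0.
  exists (tp hh (ell2_e l2 0) f); first by exists f.
  have -> : vec x - tp hh (ell2_e l2 0) f = tp hh (ell2_e l2 0) (k x - f).
    have := tp_linr hh (-1) (ell2_e l2 0) f (k x); rewrite !scaleN1r.
    by rewrite [- f + k x]addrC [- _ + _]addrC => ->.
  suff -> : nm (tp hh (ell2_e l2 0) (k x - f)) = nm (k x - f) by [].
  apply/eqP; rewrite -(@eqrXn2 _ 2) ?nm_ge0 //; apply/eqP.
  apply: (@complexI R); rewrite -!dot_nm.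
  by rewrite tp_dot ell2_dot eqxx mul1r.
have := approx_power F j ax; rewrite fvee_nseq => aj r /aj[y [_ [f ff <-] <-]
  xy].
exists (ffvee F (fun _ : 'I_j => tp hh (ell2_e l2 0) f)) => //.
rewrite -fvee_nseq; apply: span_gen.
exists (\sum_(i < size (nseq j (tp hh (ell2_e l2 0) f)))
  fvee F (set_nth 0 (nseq j (tp hh (ell2_e l2 0) f)) i
    (L (nseq j (tp hh (ell2_e l2 0) f))`_i))).
exists (nseq j (tp hh (ell2_e l2 0) f)); split=> // v.
by rewrite mem_nseq => /andP[_ /eqP ->]; apply: span_gen; exists 0, f.
Qed.

(** [comm_norm] sees only the unit ball of the domain, where the commutator is [da]. Homogeneity
    removes the normalisation, and boundedness of [da] carries the estimate to limits. *)
Lemma commutator_bound (a da : F -> F) : bounded_op da ->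
  (forall x y, D x y -> D (a x) (da x + a y)) -> (comm_norm D a <= 1%:E)%E ->
  forall x, approx (op_dom D) x -> nm (da x) <= nm x.
Proof.
move=> [lda [C C0 bda]] Da c1 x ax.
have [_ _ daB daZ] := linear_spec lda.
have dom_bound y : op_dom D y -> nm (da y) <= nm y.
  move=> [z yz]; have [y0|y0] := eqVneq (nm y) 0.
    by have := bda y; rewrite y0 mulr0.
  have ny : 0 < nm y by rewrite lt_neqAle eq_sym y0 nm_ge0.
  pose c : cplx R := (((nm y)^-1)%:C)%C.
  have nc : nm c = (nm y)^-1 by rewrite nmC ger0_norm // invr_ge0 nm_ge0.
  have yz' : D (c *: y) (c *: z) by exact: lin_extZ.
  have : ((nm (da (c *: y)))%:E <= comm_norm D a)%E.
    apply: le_ereal_sup_tmp; exists (nm (da (c *: y)))%:E => //.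
    exists (c *: y), (c *: z), (da (c *: y) + a (c *: z)); split=> //.
    - exact: Da.
    - by rewrite nmE nmZ nc mulVf.
    - by rewrite addrK.
  move=> /le_trans/(_ c1); rewrite lee_fin daZ nmZ nc mulrC.
  by rewrite ler_pdivrMr // mul1r.
apply/ler_addgt0Pl => e e0.
have c2 : 0 < C + 1 by lra.
have eE : e = (C + 1) * (e / (C + 1)) by field; rewrite gt_eqF.
have : 0 < e / (C + 1) by rewrite divr_gt0.
move: (e / _) eE => r eE r0; have [y yD xy] := ax _ r0.
have := dom_bound y yD; have := nmD (da (x - y)) (da y).
rewrite daB subrK -daB; have := nmD (y - x) x; rewrite subrK nmB.
have : nm (da (x - y)) <= C * r.
  by apply: (le_trans (bda _)); rewrite ler_wpM2l // ltW.
by rewrite eE mulrDl mul1r; lra.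
Qed.

(** By Cauchy-Schwarz the vector state of K^(m) differs from [g] by at most the relative error, so
    the limit exists and equals [g]. *)
Lemma Psi_near_eigen x a g : near_eigen (vec x) a g -> Psi k F x a = g.
Proof.
move=> ag; apply: cvg_lim; first exact: norm_hausdorff.
apply/cvg_nmP => e e0; have e2 : 0 < e / 2 by rewrite divr_gt0.
apply: filterS (ag _ e2) => m.
rewrite -/(cohvec F (vec x) m); set K := cohvec F (vec x) m => aK.
have K0 : 0 < nm K by exact: (cohvec_gt0 F w_gt0 w_sum (vec_unit x)).
rewrite nmB /vec_state.
have KC : `|K| ^+ 2 != 0 :> cplx R.
  by rewrite nmE -rmorphXn /= -[0]/((0%:C)%C) (inj_eq (@complexI R)) gt_eqF
    ?exprn_gt0.
have -> : dot K (a K) / `|K| ^+ 2 - g = dot K (a K - g *: K) / `|K| ^+ 2.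
  by rewrite dotBr dotZr dot_norm mulrBl mulfK.
have nK : nm (`|K| ^+ 2 : cplx R) = nm K ^+ 2.
  by rewrite nmE -rmorphXn nmC ger0_norm // exprn_ge0 ?nm_ge0.
have : nm (dot K (a K - g *: K) / `|K| ^+ 2) * nm K ^+ 2 <=
    nm K * (e / 2 * nm K).
  rewrite -nK -nmM divfK //; apply: (le_trans (nm_dot _ _)).
  by rewrite ler_wpM2l ?nm_ge0.
have -> : nm K * (e / 2 * nm K) = e / 2 * nm K ^+ 2 by ring.
by rewrite ler_pM2r ?exprn_gt0 //; lra.
Qed.

(** An approximate eigenvalue cannot exceed a bound for the operator on its approximate
    eigenvectors. *)
Lemma near_eigen_bound x a g :
  (forall m, nm (a (cohvec F (vec x) m)) <= nm (cohvec F (vec x) m)) ->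
  near_eigen (vec x) a g -> nm g <= 1.
Proof.
move=> aK ag; apply/ler_addgt0Pl => e e0.
have [N _ hN] := ag _ e0; have := hN N (leqnn N).
set K := cohvec F (vec x) N.
have K0 : 0 < nm K by exact: (cohvec_gt0 F w_gt0 w_sum (vec_unit x)).
rewrite /= nmB -/K => h; rewrite -(ler_pM2r K0) -nmZ.
have := nmD (g *: K - a K) (a K); rewrite subrK mulrDl mul1r.
by have := aK N; rewrite -/K; lra.
Qed.

End StarAlgebra.

Theorem corollary26 (R : realType) (d : nat) (X : topologicalType)
  (M : manifold R d X) (V : vector_field M) (Phi : R -> X -> X)
  (hPhi : is_flow V Phi)
  (H : hilbertType R) (k : X -> H) (hk : is_rkhs M k)
  (Hinf : set H) (h1 : assumption1 V k Hinf)
  (HH : tensor_product H H) (S : set H) (h2 : assumption2 k HH Hinf S)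
  (h3 : forall x : X, `|k x| = 1)
  (l2 : ell2 R) (hh : tensor_product l2 H)
  (T : forall j : nat, tensor_power hh j)
  (tau p : R) (htau : 0 < tau) (hp0 : 0 < p) (hp1 : p < 1)
  (F : fock T (weight tau p))
  (n : nat) (hn : (2 <= n)%N)
  (x y : X) (hxy : exists t : R, x = Phi t y) :
  exists t0 : R,
    [/\ x = Phi t0 y,
        (forall t : R, x = Phi t y -> `|t0| <= `|t|) &
        (conn_dist (An S F n)
           (Dgraph F (h0 hh Hinf) (Lop V k Hinf hh))
           (Psi k F x) (Psi k F y)
         <= (`|t0|)%:E)%E].
Proof.
have [t0 [xt0 mt0]] := flow_min_time hPhi hxy.
exists t0; split=> //; apply: ge_ereal_sup => _ [a [aA a1] <-].
have [da [g [g' [[ba bda] Da ag dag dg]]]] :=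
  differentiable_An hPhi hk h1 h3 htau hp0 hp1 hn (a2_sub h2) aA.
have PsiE z : Psi k F z a = g z.
  exact: (Psi_near_eigen h3 htau hp0 (ag z)).
have g'1 z : nm (g' z) <= 1.
  apply: (near_eigen_bound h3 htau hp0 _ (dag z)) => m.
  apply: (commutator_bound bda Da a1).
  exact: (@cohvec_approx _ _ _ _ _ _ _ _ h1 h3).
rewrite !PsiE lee_fin.
(* The mean value estimate is taken along the orbit of [y], between times 0 and [t0]. *)
have := cderive_lipschitz 0 t0 (dg y) (fun t => g'1 (Phi t y)).
by rewrite (flow0 hPhi) -xt0 subr0.
Qed.
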